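(* Let $\mathbb{D}\subset\mathbb{C}$ be the unit disc and $\mathbb{B}^n\subset\mathbb{R}^n$, $n\ge 3$, the open unit ball with boundary sphere $S^{n-1}$. Assume $F:\mathbb{D}\to\mathbb{B}^n$ is a conformal minimal immersion and that for some $z_0$ with $|z_0|=1$, $F$ extends to $z_0$ with $F(z_0)\in S^{n-1}$. If $dF(z_0)$ exists, then $$|dF(z_0)|\ \ge\ \frac{1-|F(0)|}{1+|F(0)|}.$$
   Context: A conformal minimal immersion $F=F(x,y)$, $z=x+iy$, is a harmonic immersion with $|F_x|=|F_y|$ and $\langle F_x,F_y\rangle=0$; $|dF|$ denotes the common length $|F_x|=|F_y|$ (the conformal factor). $|\cdot|$ on $\mathbb{R}^n$ is the Euclidean norm. *)

(* Defs.v *)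
From HB Require Import structures.
From mathcomp Require Import all_boot all_order all_algebra.
From mathcomp Require Import all_classical all_reals all_analysis.
Set Implicit Arguments. Unset Strict Implicit. Unset Printing Implicit Defensive.
Import Order.TTheory GRing.Theory Num.Theory.
Import numFieldNormedType.Exports.
Local Open Scope classical_set_scope.
Local Open Scope ring_scope.

Section Defs.
Variable R : realType.

Definition dotp n (u v : 'rV[R]_n) : R := \sum_(i < n) u 0 i * v 0 i.
Definition enorm n (v : 'rV[R]_n) : R := Num.sqrt (dotp v v).

Definition cnorm (z : R * R) : R := Num.sqrt (z.1 ^+ 2 + z.2 ^+ 2).

Definition udisc : set (R * R) := [set z | z.1 ^+ 2 + z.2 ^+ 2 < 1].

Definition e_x : R * R := (1, 0).
Definition e_y : R * R := (0, 1).

Definition partial_x n (F : R * R -> 'rV[R]_n) : R * R -> 'rV[R]_n :=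
  fun z => derive F z e_x.
Definition partial_y n (F : R * R -> 'rV[R]_n) : R * R -> 'rV[R]_n :=
  fun z => derive F z e_y.

Definition C2_on n (D : set (R * R)) (F : R * R -> 'rV[R]_n) : Prop :=
  forall z, D z ->
    [/\ differentiable F z,
        differentiable (partial_x F) z,
        differentiable (partial_y F) z,
        {for z, continuous (partial_x (partial_x F))} /\
          {for z, continuous (partial_y (partial_x F))} &
        {for z, continuous (partial_x (partial_y F))} /\
          {for z, continuous (partial_y (partial_y F))}].

Definition conformal_minimal_immersion n (F : R * R -> 'rV[R]_n) : Prop :=
  [/\ C2_on udisc F,
      (forall z, udisc z ->
         partial_x (partial_x F) z + partial_y (partial_y F) z = 0),
      (forall z, udisc z ->
         enorm (partial_x F z) = enorm (partial_y F z)
         /\ dotp (partial_x F z) (partial_y F z) = 0) &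
      (forall z, udisc z -> partial_x F z != 0)].

(* F (restricted to D u {z0}) is differentiable at z0 relative to D u {z0},
   with differential (x, y) |-> x a + y b, i.e. F_x(z0) = a, F_y(z0) = b. *)
Definition boundary_differential n (F : R * R -> 'rV[R]_n) (z0 : R * R)
    (a b : 'rV[R]_n) : Prop :=
  forall eps : R, 0 < eps -> exists2 delta : R, 0 < delta &
    forall z, udisc z -> cnorm (z - z0) < delta ->
      enorm (F z - F z0 - ((z.1 - z0.1) *: a + (z.2 - z0.2) *: b))
        <= eps * cnorm (z - z0).

End Defs.

(* Main.v *)
Require Import Defs.
From HB Require Import structures.
From mathcomp Require Import all_boot all_order all_algebra.
From mathcomp Require Import all_classical all_reals all_analysis.
From mathcomp Require Import ring lra.
Import Order.TTheory GRing.Theory Num.Theory.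
Import numFieldNormedType.Exports.
Local Open Scope classical_set_scope.
Local Open Scope ring_scope.
Set Implicit Arguments. Unset Strict Implicit. Unset Printing Implicit Defensive.

(* Let w be a point of the disc with s = |F(w)| > 0, let q = F(w)/s and let phi
   be the disc automorphism sending 0 to w.  On a circle |z| = r < 1, pair
   F o phi with the unit vector field spanned by q and a tangent vector whose
   complex coordinate is (z + s)/(1 + s z); after multiplication by |1 + s z|^2
   both sides of Cauchy-Schwarz are trigonometric polynomials of degree one, so
   averaging only involves F(w) and dF(w).  Conformality turns the outcome into
   |grad (F . q)(w)| <= (1 - s^2)/(1 - |w|^2), i.e. artanh |F(r z0)| grows at
   most like artanh r along the radius, whence
   1 - |F(r z0)| >= (1 - r)(1 - |F(0)|)/(1 + |F(0)|).  This bounds the radial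
   derivative at z0, and the limit differential at z0 is again conformal by
   interior gradient estimates on discs shrinking to z0.

   Circle averages are finite ones over roots of unity, compared with their
   limits by the maximum principle, so no integration is needed. *)

(** * Maximum principle *)

(** A single real harmonic function bounded by 1 can have a gradient of length 4/pi at the centre,
    so estimating F . q alone loses the sharp constant. The second component F . v repairs this: by
    conformality its derivative at w is |dF|, which is at least |grad (F . q)|. Averaging gives the
    two derivatives the weights (1 + s^2)/2 and (1 - s^2)/2, whose sum is 1, so replacing the larger
    by the smaller leaves exactly |grad (F . q)|.

    The field (z + s)/(1 + s z) is dictated by the extremal case: when F o phi is itself this map
    into a plane disc, Cauchy-Schwarz is an equality on |z| = 1.

    Two obstacles shape the rest. The norm |F| need not be differentiable at zeros of F, so the
    growth estimate is a comparison at a maximum instead of an integrated differential inequality.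
    At z0 only a first-order expansion from inside the disc is given, and growth controls only the
    radial derivative, while the claim concerns F_x(z0); conformality of the limit differential
    links the two. *)

Lemma near_at0P {R : realType} (P : R -> Prop) :
  (\forall s \near (0 : R), P s) -> exists2 d : R, 0 < d & forall s, `|s| < d -> P s.
Proof.
move=> /nbhs_ballP[d /= d0 H]; exists d => // s sd; apply: H.
by rewrite /ball /= sub0r normrN.
Qed.

Lemma near_at0 {R : realType} (P : R -> Prop) (d : R) :
  0 < d -> (forall s, `|s| < d -> P s) -> \forall s \near (0 : R), P s.
Proof.
move=> d0 H; apply/nbhs_ballP; exists d => //= s.
by rewrite /ball /= sub0r normrN; apply: H.
Qed.

Lemma is_derive_eps {R : realType} (f : R -> R) (x c : R) :
  is_derive x 1 f c -> forall e, 0 < e ->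
  exists2 d : R, 0 < d & forall h, `|h| < d -> `|f (x + h) - f x - c * h| <= e * `|h|.
Proof.
move=> [fd fc] e e0.
move: fc; rewrite /derive => fc; move: (fd); rewrite /derivable fc.
move/cvgrPdist_le => /(_ e e0) /nbhs_ballP[d /= d0 H].
exists d => // h hd; have [->|h0] := eqVneq h 0.
  by rewrite addr0 mulr0 subrr subr0 normr0 mulr0.
have := H h; rewrite /ball /= sub0r normrN => /(_ hd h0).
rewrite distrC /GRing.scale /= mulr1 => K.
have -> : f (x + h) - f x - c * h = (h^-1 * (f (h + x) - f x) - c) * h.
  by rewrite mulrBl mulrAC mulVf // mul1r addrC [h + x]addrC addrC.
by rewrite normrM ler_wpM2r.
Qed.

Lemma is_derive_max {R : realType} (f : R -> R) (c : R) :
  is_derive (0 : R) 1 f c -> (\forall s \near (0 : R), f s <= f 0) -> c = 0.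
Proof.
move=> fc /near_at0P[d d0 fmax]; apply: contrapT => /eqP c0.
have e0 : 0 < `|c| / 2 by rewrite divr_gt0 // normr_gt0.
have [d' d'0 H] := is_derive_eps fc e0.
pose m := Num.min d d' / 2; have m0 : 0 < m by rewrite divr_gt0 // lt_min d0.
have [md md'] : m < d /\ m < d'.
  have : Num.min d d' <= d /\ Num.min d d' <= d' by rewrite !ge_min !lexx orbT.
  by rewrite /m => -[? ?]; split; apply: (@lt_le_trans _ _ (Num.min d d')) => //; rewrite /m in m0; lra.
have [cp|cn] := ltrP 0 c.
  have := H m; rewrite gtr0_norm // => /(_ md').
  have := fmax m; rewrite gtr0_norm // => /(_ md).
  rewrite add0r (gtr0_norm cp) ler_norml; nra.
have cn' : c < 0 by rewrite lt_neqAle c0.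
have := H (- m); rewrite normrN gtr0_norm // => /(_ md').
have := fmax (- m); rewrite normrN gtr0_norm // => /(_ md).
rewrite add0r (ltr0_norm cn') ler_norml; nra.
Qed.

(** The first derivative is a witness valid near 0, so that no iterated [derive] has to be computed
    and sums, multiples and reflections are handled on the witness. *)
Definition has_derive2 {R : realType} (f : R -> R) (c : R) : Prop :=
  exists f1 : R -> R,
    (\forall s \near (0 : R), is_derive (s : R) 1 f (f1 s)) /\ is_derive (0 : R) 1 f1 c.

(** If c > 0, the first derivative vanishes at 0 and is at least (c/2) x for small x > 0, so the
    mean value theorem makes f exceed f 0. *)
Lemma has_derive2_max {R : realType} (f : R -> R) (c : R) :
  has_derive2 f c -> (\forall s \near (0 : R), f s <= f 0) -> c <= 0.
Proof.
move=> [f1 [f1P f1c]] fmax; rewrite leNgt; apply/negP => c0.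
have f10 : f1 0 = 0 by apply: is_derive_max fmax; exact: nbhs_singleton f1P.
have [d d0 H] := near_at0P f1P; have [d1 d10 H1] := near_at0P fmax.
have c20 : 0 < c / 2 by rewrite divr_gt0.
have [d2 d20 H2] := is_derive_eps f1c c20.
pose M := Num.min d (Num.min d1 d2).
have M0 : 0 < M by rewrite !lt_min d0 d10.
have [Md [Md1 Md2]] : M <= d /\ M <= d1 /\ M <= d2.
  by rewrite /M !ge_min !lexx !orbT.
pose m := M / 2; have m0 : 0 < m by rewrite divr_gt0.
have mM : m < M by rewrite /m; lra.
have [x] : exists2 x, x \in `]0, m[ & f m - f 0 = f1 x * (m - 0).
  apply: MVT => // [x|].
    rewrite in_itv /= => /andP[x0 xm]; apply: H.
    by rewrite gtr0_norm //; lra.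
  apply: derivable_within_continuous => x; rewrite in_itv /= => /andP[x0 xm].
  suff : is_derive x 1 f (f1 x) by case.
  by apply: H; rewrite ger0_norm //; lra.
rewrite in_itv /= subr0 => /andP[x0 xm] E.
have := H1 m; rewrite gtr0_norm // => /(_ ltac:(lra)) fm.
have := H2 x; rewrite gtr0_norm // => /(_ ltac:(lra)).
rewrite add0r f10 subr0 ler_norml => /andP[K _].
have : 0 < f1 x by nra.
by move=> f1x; have := mulr_gt0 f1x m0; rewrite -E; lra.
Qed.

Lemma has_derive2D {R : realType} (f g : R -> R) (a b : R) :
  has_derive2 f a -> has_derive2 g b -> has_derive2 (fun s => f s + g s) (a + b).
Proof.
move=> [f1 [fP ?]] [g1 [gP ?]]; exists (fun s => f1 s + g1 s); split.
  by apply: filterS2 fP gP => s; exact: is_deriveD.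
exact: is_deriveD.
Qed.

Lemma has_derive2Z {R : realType} (f : R -> R) (k a : R) :
  has_derive2 f a -> has_derive2 (fun s => k * f s) (k * a).
Proof.
move=> [f1 [fP ?]]; exists (fun s => k * f1 s); split.
  by apply: filterS fP => s; exact: is_deriveZ.
exact: is_deriveZ.
Qed.

Lemma has_derive2_opp {R : realType} (f : R -> R) (a : R) :
  has_derive2 f a -> has_derive2 (fun s => f (- s)) a.
Proof.
move=> [f1 [/near_at0P[d d0 H] f1a]]; exists (fun s => - f1 (- s)); split.
  apply: (near_at0 d0) => s sd; rewrite -mulrN1.
  by apply: is_derive1_comp; apply: H; rewrite normrN.
have -> : a = - (a * -1) by rewrite mulrN1 opprK.
by apply: is_deriveN; apply: is_derive1_comp; rewrite oppr0.
Qed.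

Lemma has_derive2_quad {R : realType} (a b c : R) :
  has_derive2 (fun s => a + b * s + c * s ^+ 2) (2 * c).
Proof.
exists (fun s => b + 2 * c * s); split.
  by apply: (near_at0 ltr01) => s _; apply: is_derive_eq; rewrite /GRing.scale /=; ring.
by apply: is_derive_eq; rewrite /GRing.scale /=; ring.
Qed.

(* Only the restrictions of [g] to the two coordinate lines through [z] enter,
   which is what composition with a Moebius map preserves without having to
   compute second partial derivatives off the lines. *)
Definition laplacian_at {R : realType} (g : R * R -> R) (z : R * R) (l : R) :=
  exists cx cy : R, [/\ has_derive2 (fun s => g (z.1 + s, z.2)) cx,
    has_derive2 (fun s => g (z.1, z.2 + s)) cy & cx + cy = l].

Lemma laplacian_atD {R : realType} (f g : R * R -> R) z a b :
  laplacian_at f z a -> laplacian_at g z b ->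
  laplacian_at (fun w => f w + g w) z (a + b).
Proof.
move=> [c [c' [h h' <-]]] [k [k' [j j' <-]]]; exists (c + k), (c' + k'); split.
- exact: has_derive2D.
- exact: has_derive2D.
- by rewrite addrACA.
Qed.

Lemma laplacian_atZ {R : realType} (f : R * R -> R) z k a :
  laplacian_at f z a -> laplacian_at (fun w => k * f w) z (k * a).
Proof.
move=> [c [c' [h h' <-]]]; exists (k * c), (k * c'); split.
- exact: has_derive2Z.
- exact: has_derive2Z.
- by rewrite mulrDr.
Qed.

(** Covers every explicit function used below: affine ones, the harmonic barrier, and the strictly
    subharmonic perturbation of the maximum principle. *)
Lemma laplacian_at_quad {R : realType} (a b c p q : R) z :
  laplacian_at (fun w : R * R => a + b * w.1 + c * w.2 + p * w.1 ^+ 2 + q * w.2 ^+ 2)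
    z (2 * p + 2 * q).
Proof.
exists (2 * p), (2 * q); split => //=.
- rewrite [X in has_derive2 X _](_ : _ = (fun s => (a + b * z.1 + c * z.2 +
    p * z.1 ^+ 2 + q * z.2 ^+ 2) + (b + 2 * p * z.1) * s + p * s ^+ 2)).
    exact: has_derive2_quad.
  by apply/funext => s /=; ring.
- rewrite [X in has_derive2 X _](_ : _ = (fun s => (a + b * z.1 + c * z.2 +
    p * z.1 ^+ 2 + q * z.2 ^+ 2) + (c + 2 * q * z.2) * s + q * s ^+ 2)).
    exact: has_derive2_quad.
  by apply/funext => s /=; ring.
Qed.

Lemma laplacian_at_sum {R : realType} (N : nat) (f : nat -> R * R -> R) z :
  (forall j, laplacian_at (f j) z 0) ->
  laplacian_at (fun w => \sum_(0 <= j < N) f j w) z 0.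
Proof.
move=> H; elim: N => [|N IH].
  rewrite (_ : (fun w => _) = (fun w : R * R => 0 + 0 * w.1 + 0 * w.2 +
    0 * w.1 ^+ 2 + 0 * w.2 ^+ 2)); last first.
    by apply/funext => w; rewrite big_nil; ring.
  by have := laplacian_at_quad 0 0 0 0 0 z; rewrite !mulr0 addr0.
rewrite (_ : (fun w => _) = (fun w => \sum_(0 <= j < N) f j w + f N w)); last first.
  by apply/funext => w; rewrite big_nat_recr.
by have := laplacian_atD IH (H N); rewrite addr0.
Qed.

Lemma near_line1 {R : realType} (z : R * R) (P : R * R -> Prop) :
  (\forall w \near z, P w) -> \forall s \near (0 : R), P (z.1 + s, z.2).
Proof.
move=> zP; have c : (z.1 + s, z.2) @[s --> (0 : R)] --> (z.1 + 0, z.2).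
  have h1 : z.1 + s @[s --> (0 : R)] --> z.1 + 0 by apply: cvgD; [exact: cvg_cst|exact: cvg_id].
  have h2 : z.2 @[s --> (0 : R)] --> z.2 by exact: cvg_cst.
  exact: (cvg_pair h1 h2).
by rewrite addr0 -surjective_pairing in c; exact: (c _ zP).
Qed.

Lemma near_line2 {R : realType} (z : R * R) (P : R * R -> Prop) :
  (\forall w \near z, P w) -> \forall s \near (0 : R), P (z.1, z.2 + s).
Proof.
move=> zP; have c : (z.1, z.2 + s) @[s --> (0 : R)] --> (z.1, z.2 + 0).
  have h1 : z.2 + s @[s --> (0 : R)] --> z.2 + 0 by apply: cvgD; [exact: cvg_cst|exact: cvg_id].
  have h2 : z.1 @[s --> (0 : R)] --> z.1 by exact: cvg_cst.
  exact: (cvg_pair h2 h1).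
by rewrite addr0 -surjective_pairing in c; exact: (c _ zP).
Qed.

Lemma laplacian_at_max {R : realType} (g : R * R -> R) z l :
  laplacian_at g z l -> (\forall w \near z, g w <= g z) -> l <= 0.
Proof.
move=> [c [c' [h h' <-]]] gmax; rewrite -[0]addr0; apply: lerD.
  apply: (has_derive2_max h); have := near_line1 gmax.
  by apply: filterS => s; rewrite addr0; case: (z).
apply: (has_derive2_max h'); have := near_line2 gmax.
by apply: filterS => s; rewrite addr0; case: (z).
Qed.

(** Adding a small multiple of x^2 makes the Laplacian positive, which excludes a maximum at a point
    of the second kind. The disjunction replaces any mention of the boundary of K. *)
Lemma maximum_principle {R : realType} (K : set (R * R)) (g : R * R -> R) (M : R) :
  compact K -> (forall z, K z -> {for z, continuous g}) ->
  (forall z, K z -> g z <= M \/ ((\forall w \near z, K w) /\ laplacian_at g z 0)) ->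
  forall z, K z -> g z <= M.
Proof.
move=> Kc gc H z Kz; apply/ler_addgt0Pr => e e0.
have K0 : K !=set0 by exists z.
have cc (f : R * R -> R) : (forall z, K z -> {for z, continuous f}) -> {within K, continuous f}.
  move=> fc; apply: continuous_in_subspaceT => w; rewrite inE; exact: fc.
have x2c (w : R * R) : {for w, continuous (fun z : R * R => z.1 ^+ 2)}.
  by apply: (@continuous_comp _ _ _ fst (fun x : R => x ^+ 2)); [exact: cvg_fst|exact: exprn_continuous].
have [b Kb bP] : exists2 b, b \in K & forall t, t \in K -> t.1 ^+ 2 <= b.1 ^+ 2.
  by apply: (@compact_EVT_max _ _ (fun z : R * R => z.1 ^+ 2)) => //; apply: cc => w _; exact: x2c.
(* Since b maximises x^2 on K, the perturbation d x^2 is at most e there. *)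
pose d := e / (1 + b.1 ^+ 2).
have b20 : 0 < 1 + b.1 ^+ 2 by have := sqr_ge0 b.1; lra.
have d0 : 0 < d by rewrite divr_gt0.
have [m Km mP] : exists2 m, m \in K & forall t, t \in K ->
    g t + d * t.1 ^+ 2 <= g m + d * m.1 ^+ 2.
  apply: (@compact_EVT_max _ _ (fun z : R * R => g z + d * z.1 ^+ 2)) => //; apply: cc => w Kw.
  by apply: continuousD; [exact: gc|apply: continuousM; [exact: cst_continuous|exact: x2c]].
have Hz := mP z (mem_set Kz).
have mM : g m <= M.
  have [//|[nK lg]] := H m (set_mem Km).
  (* At an interior maximum the perturbed Laplacian, equal to 2 d, would have to be nonpositive. *)
  have : 0 + (2 * d + 2 * 0) <= 0.
    apply: (@laplacian_at_max _ (fun w : R * R => g w +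
      (0 + 0 * w.1 + 0 * w.2 + d * w.1 ^+ 2 + 0 * w.2 ^+ 2)) m).
      by apply: laplacian_atD => //; exact: laplacian_at_quad.
    move: nK; apply: filterS => w Kw; rewrite !mul0r !add0r !addr0.
    exact: mP (mem_set Kw).
  by lra.
have : d * m.1 ^+ 2 <= e.
  have : d * m.1 ^+ 2 <= d * b.1 ^+ 2 by rewrite ler_pM2l //; exact: bP.
  move/le_trans; apply; rewrite /d mulrAC ler_pdivrMr //.
  by rewrite ler_pM2l //; lra.
have : 0 <= d * z.1 ^+ 2 by rewrite mulr_ge0 ?sqr_ge0 // ltW.
by lra.
Qed.

(** * Interior gradient estimate *)

Lemma near_box {R : realType} (w : R * R) (P : R * R -> Prop) (r : R) : 0 < r ->
  (forall v : R * R, `|v.1 - w.1| < r -> `|v.2 - w.2| < r -> P v) ->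
  \forall v \near w, P v.
Proof.
move=> r0 H; apply/nbhs_ballP; exists r => //= v [/= b1 b2].
by apply: H; rewrite distrC.
Qed.

(** The derivative at 0 depends only on the odd part, as f(y) - f(-y) = 2 c y + o(y). *)
Lemma is_derive_odd_part {R : realType} (f : R -> R) (c k : R) (d : R) : 0 < d ->
  is_derive (0 : R) 1 f c ->
  (forall y, 0 < y -> y < d -> `|f y - f (- y)| <= 2 * k * y) -> `|c| <= k.
Proof.
move=> d0 fc H; apply/ler_addgt0Pr => e e0.
have [d' d'0 H'] := is_derive_eps fc e0.
pose m := Num.min d d' / 2; have m0 : 0 < m by rewrite divr_gt0 // lt_min d0.
have [md md'] : m < d /\ m < d'.
  have : Num.min d d' <= d /\ Num.min d d' <= d' by rewrite !ge_min !lexx orbT.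
  by rewrite /m => -[? ?]; split; apply: (@lt_le_trans _ _ (Num.min d d')) => //; rewrite /m in m0; lra.
have := H m m0 md; have := H' m; have := H' (- m).
rewrite normrN gtr0_norm // => /(_ md') + /(_ md').
rewrite !add0r !ler_norml => /andP[A1 A2] /andP[B1 B2] /andP[C1 C2].
apply/andP; split; nra.
Qed.

(* The odd part of [u] in the second variable is compared on the upper half of
   the square with the harmonic barrier M/d^2 (x^2 + 2dy - y^2), which dominates
   M on the three outer sides and vanishes at the centre. *)
Lemma gradient_bound2 {R : realType} (u : R * R -> R) (z : R * R) (d M c : R) :
  0 < d ->
  (forall w : R * R, `|w.1 - z.1| <= d -> `|w.2 - z.2| <= d ->
     [/\ {for w, continuous u}, laplacian_at u w 0 & `|u w| <= M]) ->
  is_derive (0 : R) 1 (fun s => u (z.1, z.2 + s)) c -> `|c| <= 2 * M / d.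
Proof.
move=> d0 H uc; apply: (is_derive_odd_part d0 uc) => y y0 yd.
have M0 : 0 <= M.
  have [_ _] := H z ltac:(by rewrite subrr normr0 ltW) ltac:(by rewrite subrr normr0 ltW).
  exact: le_trans.
pose k := M / d ^+ 2; have k0 : 0 <= k by rewrite divr_ge0 // sqr_ge0.
have kd : k * d ^+ 2 = M by rewrite /k divfK // expf_neq0 // gt_eqF.
pose K : set (R * R) := `[z.1 - d, z.1 + d] `*` `[z.2, z.2 + d].
have KP w : K w <-> [/\ z.1 - d <= w.1, w.1 <= z.1 + d, z.2 <= w.2 & w.2 <= z.2 + d].
  rewrite /K /=; split=> [[]|[]]; rewrite /= !in_itv /=.
    by move=> /andP[? ?] /andP[? ?].
  by move=> -> -> -> ->.
have KH w : K w -> [/\ {for w, continuous u}, laplacian_at u w 0 & `|u w| <= M].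
  by move=> /KP[? ? ? ?]; apply: H; rewrite ler_norml; apply/andP; split; lra.
have KH' w : K w -> [/\ {for (w.1, 2 * z.2 - w.2), continuous u},
    laplacian_at u (w.1, 2 * z.2 - w.2) 0 & `|u (w.1, 2 * z.2 - w.2)| <= M].
  by move=> /KP[? ? ? ?]; apply: H; rewrite ler_norml /=; apply/andP; split; lra.
pose psi (w : R * R) := k * ((w.1 - z.1) * (w.1 - z.1) + 2 * d * (w.2 - z.2) - (w.2 - z.2) * (w.2 - z.2)).
(* The values t = 1/2 and t = -1/2 give the odd part and its negative. *)
have step (t : R) (t2 : `|t| = 1 / 2) w : K w ->
    t * u w + (- t) * u (w.1, 2 * z.2 - w.2) <= psi w.
  move=> Kw; rewrite -subr_le0.
  have Kc : compact K by apply: compact_setX; exact: segment_compact.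
  apply: (maximum_principle (K := K)
    (g := fun w => t * u w + (- t) * u (w.1, 2 * z.2 - w.2) - psi w)) Kw => // {}w Kw.
    have [uw _ _] := KH w Kw; have [uw' _ _] := KH' w Kw.
    have c1 : {for w, continuous (fun w : R * R => w.1)} by exact: cvg_fst.
    have c2 : {for w, continuous (fun w : R * R => w.2)} by exact: cvg_snd.
    have cc (a : R) : {for w, continuous (fun _ : R * R => a)} by exact: cst_continuous.
    have cr : {for w, continuous (fun w : R * R => (w.1, 2 * z.2 - w.2))}.
      have c3 : {for w, continuous (fun w : R * R => 2 * z.2 - w.2)} by apply: continuousB.
      exact: (cvg_pair c1 c3).
    apply: continuousB.
      apply: continuousD; first by apply: continuousM.
      by apply: continuousM => //; apply: (@continuous_comp _ _ _ (fun w : R * R => (w.1, 2 * z.2 - w.2)) u).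
    have c1z : {for w, continuous (fun w : R * R => w.1 - z.1)} by apply: continuousB.
    have c2z : {for w, continuous (fun w : R * R => w.2 - z.2)} by apply: continuousB.
    apply: continuousM => //; apply: continuousB; last exact: continuousM.
    by apply: continuousD; apply: continuousM.
  have [_ lu uM] := KH w Kw; have [_ lu' uM'] := KH' w Kw.
  have diffM : t * u w + - t * u (w.1, 2 * z.2 - w.2) <= M.
    have : `|t * u w + - t * u (w.1, 2 * z.2 - w.2)| <= M.
      apply: le_trans (ler_normD _ _) _; rewrite !normrM normrN t2; lra.
    by rewrite ler_norml => /andP[].
  move/KP: (Kw) => [w1 w2 w3 w4].
  have psiM : w.1 = z.1 - d \/ w.1 = z.1 + d \/ w.2 = z.2 + d -> M <= psi w.
    rewrite /psi -kd => E; rewrite ler_wpM2l //.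
    have p1 : 0 <= (w.2 - z.2) * (2 * d - (w.2 - z.2)) by apply: mulr_ge0; lra.
    have p2 : 0 <= (w.1 - z.1) ^+ 2 by exact: sqr_ge0.
    by case: E => [E|[E|E]]; rewrite E in p1 p2 *; lra.
  (* On the bottom side w is its own reflection, so the odd part is 0 and the barrier is
     nonnegative. *)
  have [w2z|w2z] := eqVneq w.2 z.2.
    left; have -> : (w.1, 2 * z.2 - w.2) = w.
      by rewrite w2z [RHS]surjective_pairing w2z; congr (_, _); ring.
    rewrite mulNr subrr sub0r oppr_le0 /psi w2z subrr !mulr0 subr0 addr0 mulr_ge0 //.
    by rewrite -expr2 sqr_ge0.
  have [w1z|w1z] := eqVneq w.1 (z.1 - d); first by left; have := psiM (or_introl w1z); lra.
  have [w1z'|w1z'] := eqVneq w.1 (z.1 + d).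
    by left; have := psiM (or_intror (or_introl w1z')); lra.
  have [w2z'|w2z'] := eqVneq w.2 (z.2 + d).
    by left; have := psiM (or_intror (or_intror w2z')); lra.
  right; split.
    have [a1 a2 a3 a4] : [/\ z.1 - d < w.1, w.1 < z.1 + d, z.2 < w.2 & w.2 < z.2 + d].
      by rewrite !lt_neqAle w1 w2 w3 w4 w1z' w2z' eq_sym w1z eq_sym w2z.
    pose r := Num.min (Num.min (w.1 - (z.1 - d)) (z.1 + d - w.1))
      (Num.min (w.2 - z.2) (z.2 + d - w.2)).
    have r0 : 0 < r by rewrite !lt_min; apply/andP; split; apply/andP; split; lra.
    apply: (near_box r0) => v; rewrite !lt_min !ltr_norml.
    by move=> A1 A2; apply/KP; clear -A1 A2; split; lra.
  have psiL : laplacian_at (fun w => - psi w) w 0.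
    have -> : (fun w => - psi w) = (fun w : R * R => (k * (2 * d * z.2 + z.2 ^+ 2 - z.1 ^+ 2)) +
        (2 * k * z.1) * w.1 + (- 2 * k * (d + z.2)) * w.2 + (- k) * w.1 ^+ 2 + k * w.2 ^+ 2).
      by apply/funext => v; rewrite /psi; ring.
    by have := laplacian_at_quad (k * (2 * d * z.2 + z.2 ^+ 2 - z.1 ^+ 2))
      (2 * k * z.1) (- 2 * k * (d + z.2)) (- k) k w; rewrite mulrN addNr.
  have reflL : laplacian_at (fun w => u (w.1, 2 * z.2 - w.2)) w 0.
    have [cx [cy [hx hy E]]] := lu'; exists cx, cy; split => //=.
    rewrite (_ : (fun s => _) = (fun s => u (w.1, 2 * z.2 - w.2 + - s))); first exact: has_derive2_opp hy.
    by apply/funext => s; congr (u (_, _)); ring.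
  have := laplacian_atD (laplacian_atD (laplacian_atZ t lu) (laplacian_atZ (- t) reflL)) psiL.
  by rewrite !mulr0 !addr0.
have Ky : K (z.1, z.2 + y) by apply/KP; split => /=; lra.
have := step (1 / 2) _ _ Ky; have := step (- (1 / 2)) _ _ Ky.
rewrite normrN gtr0_norm // => /(_ erefl) + /(_ erefl); rewrite /psi /=.
have -> : 2 * z.2 - (z.2 + y) = z.2 + - y by ring.
(* The bound 2 M / d is the vertical slope 2 k d of the barrier at the centre. *)
have -> : 2 * (2 * M / d) * y = 2 * k * (2 * d * y) by rewrite /k; field; lra.
have : 0 <= k * (y * y) by rewrite mulr_ge0 // mulr_ge0 // ltW.
by move=> ? ? ?; rewrite ler_norml; apply/andP; split; lra.
Qed.

Lemma gradient_bound1 {R : realType} (u : R * R -> R) (z : R * R) (d M c : R) :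
  0 < d ->
  (forall w : R * R, `|w.1 - z.1| <= d -> `|w.2 - z.2| <= d ->
     [/\ {for w, continuous u}, laplacian_at u w 0 & `|u w| <= M]) ->
  is_derive (0 : R) 1 (fun s => u (z.1 + s, z.2)) c -> `|c| <= 2 * M / d.
Proof.
move=> d0 H uc.
apply: (@gradient_bound2 _ (fun w => u (w.2, w.1)) (z.2, z.1) d M c) => // w w1 w2.
have [cu [cx [cy [hx hy E]]] uM] := H (w.2, w.1) w2 w1; split => //.
  have cs : {for w, continuous (fun w : R * R => (w.2, w.1))}.
    have c1 : {for w, continuous (fun w : R * R => w.1)} by exact: cvg_fst.
    have c2 : {for w, continuous (fun w : R * R => w.2)} by exact: cvg_snd.
    exact: (cvg_pair c2 c1).
  exact: (@continuous_comp _ _ _ (fun w : R * R => (w.2, w.1)) u).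
by exists cy, cx; split => //; rewrite addrC.
Qed.

(** * Composition with disc automorphisms *)

(** Differentiability of the first partials is what lets the chain rule along a curve be applied
    twice. *)
Definition harmonic_on {R : realType} (D : set (R * R)) (h : R * R -> R) : Prop :=
  forall z, D z ->
    [/\ differentiable h z, differentiable ('D_(e_x R) h) z,
        differentiable ('D_(e_y R) h) z &
        'D_(e_x R) ('D_(e_x R) h) z + 'D_(e_y R) ('D_(e_y R) h) z = 0].

Lemma is_derive_curve {R : realType} (h : R * R -> R) (X Y : R -> R) (s a b : R) :
  differentiable h (X s, Y s) -> is_derive s 1 X a -> is_derive s 1 Y b ->
  is_derive s 1 (fun t => h (X t, Y t))
    (a * 'D_(e_x R) h (X s, Y s) + b * 'D_(e_y R) h (X s, Y s)).
Proof.
move=> hd [Xd Xa] [Yd Yb].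
have dX : differentiable X s by apply/derivable1_diffP.
have dY : differentiable Y s by apply/derivable1_diffP.
have dc : differentiable (fun t => (X t, Y t)) s by exact: differentiable_pair.
have dh : differentiable (h \o (fun t => (X t, Y t))) s by exact: differentiable_comp.
apply: DeriveDef; first by apply/derivable1_diffP.
rewrite (deriveE _ dh) (diff_comp dc hd) /= (diff_pair dX dY) /=.
rewrite -!deriveE // Xa Yb.
have -> : (a, b) = a *: e_x R + b *: e_y R.
  by rewrite /e_x /e_y; congr (_, _) => /=; rewrite /GRing.scale /= ?mulr1 ?mulr0 ?addr0 ?add0r.
rewrite !deriveE // linearD !linearZ //.
Qed.

(** Real part of the complex quotient rule (N' D - N D') / D^2, where D^2 has coordinates D1^2 -
    D2^2 and 2 D1 D2. *)
Lemma is_derive_cdiv1 {R : realType} (N1 N2 D1 D2 : R -> R) (s n1 n2 d1 d2 : R) :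
  is_derive s 1 N1 n1 -> is_derive s 1 N2 n2 ->
  is_derive s 1 D1 d1 -> is_derive s 1 D2 d2 ->
  D1 s ^+ 2 + D2 s ^+ 2 != 0 ->
  is_derive s 1 (fun t => (N1 t * D1 t + N2 t * D2 t) / (D1 t ^+ 2 + D2 t ^+ 2))
   (((n1 * D1 s - n2 * D2 s - N1 s * d1 + N2 s * d2) * (D1 s ^+ 2 - D2 s ^+ 2) +
     (n1 * D2 s + n2 * D1 s - N1 s * d2 - N2 s * d1) * (2 * D1 s * D2 s)) /
    ((D1 s ^+ 2 - D2 s ^+ 2) ^+ 2 + (2 * D1 s * D2 s) ^+ 2)).
Proof.
move=> h1 h2 h3 h4 D0.
have Q0 : (D1 s ^+ 2 - D2 s ^+ 2) ^+ 2 + (2 * D1 s * D2 s) ^+ 2 != 0.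
  rewrite (_ : _ + _ = (D1 s ^+ 2 + D2 s ^+ 2) ^+ 2); first by rewrite expf_neq0.
  by ring.
have hV : is_derive s 1 (fun t => (D1 t ^+ 2 + D2 t ^+ 2)^-1)
   (- (D1 s ^+ 2 + D2 s ^+ 2) ^- 2 *: (2 * D1 s * d1 + 2 * D2 s * d2)).
  apply: is_deriveV => //; apply: is_derive_eq.
  by rewrite /GRing.scale /=; ring.
apply: is_derive_eq.
rewrite /GRing.scale /=; field.
by rewrite D0 Q0.
Qed.

(** The imaginary part of N/D is the real part of (-i N)/D. *)
Lemma is_derive_cdiv2 {R : realType} (N1 N2 D1 D2 : R -> R) (s n1 n2 d1 d2 : R) :
  is_derive s 1 N1 n1 -> is_derive s 1 N2 n2 ->
  is_derive s 1 D1 d1 -> is_derive s 1 D2 d2 ->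
  D1 s ^+ 2 + D2 s ^+ 2 != 0 ->
  is_derive s 1 (fun t => (N2 t * D1 t - N1 t * D2 t) / (D1 t ^+ 2 + D2 t ^+ 2))
   (((n1 * D2 s + n2 * D1 s - N1 s * d2 - N2 s * d1) * (D1 s ^+ 2 - D2 s ^+ 2) -
     (n1 * D1 s - n2 * D2 s - N1 s * d1 + N2 s * d2) * (2 * D1 s * D2 s)) /
    ((D1 s ^+ 2 - D2 s ^+ 2) ^+ 2 + (2 * D1 s * D2 s) ^+ 2)).
Proof.
move=> h1 h2 h3 h4 D0.
have h1' : is_derive s 1 (fun t => - N1 t) (- n1) by exact: is_deriveN.
have := is_derive_cdiv1 h2 h1' h3 h4 D0.
rewrite (_ : (fun t => (N2 t * D1 t + _) / _) =
  (fun t => (N2 t * D1 t - N1 t * D2 t) / (D1 t ^+ 2 + D2 t ^+ 2))); last first.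
  by apply/funext => t; rewrite mulNr.
by move=> H; apply: is_derive_eq; congr (_ / _); ring.
Qed.

Lemma has_derive2_curve {R : realType} (D : set (R * R)) (h : R * R -> R)
  (X Y X1 Y1 : R -> R) (X2 Y2 : R) : harmonic_on D h ->
  (\forall s \near (0 : R), D (X s, Y s)) ->
  (\forall s \near (0 : R), is_derive (s : R) 1 X (X1 s)) ->
  (\forall s \near (0 : R), is_derive (s : R) 1 Y (Y1 s)) ->
  is_derive (0 : R) 1 X1 X2 -> is_derive (0 : R) 1 Y1 Y2 ->
  has_derive2 (fun s => h (X s, Y s))
    (let p := (X 0, Y 0) in
     X2 * 'D_(e_x R) h p + Y2 * 'D_(e_y R) h p +
     (X1 0 ^+ 2 * 'D_(e_x R) ('D_(e_x R) h) p + Y1 0 ^+ 2 * 'D_(e_y R) ('D_(e_y R) h) p +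
      X1 0 * Y1 0 * ('D_(e_y R) ('D_(e_x R) h) p + 'D_(e_x R) ('D_(e_y R) h) p))).
Proof.
move=> hh nD nX nY hX hY /=.
have [_ hxd hyd _] := hh _ (nbhs_singleton nD).
have X0 := nbhs_singleton nX; have Y0 := nbhs_singleton nY.
exists (fun s => X1 s * 'D_(e_x R) h (X s, Y s) + Y1 s * 'D_(e_y R) h (X s, Y s)); split.
  apply: filterS3 nD nX nY => s Ds Xs Ys; have [hd _ _ _] := hh _ Ds.
  exact: is_derive_curve.
have k1 := is_derive_curve hxd X0 Y0; have k2 := is_derive_curve hyd X0 Y0.
apply: (is_derive_eq (is_deriveD (is_deriveM hX k1) (is_deriveM hY k2))).
move: ('D_(e_x R) ('D_(e_x R) h) _) => hxx; move: ('D_(e_y R) ('D_(e_x R) h) _) => hyx.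
move: ('D_(e_x R) ('D_(e_y R) h) _) => hxy; move: ('D_(e_y R) ('D_(e_y R) h) _) => hyy.
move: ('D_(e_x R) h _) ('D_(e_y R) h _) => hx hy.
by rewrite /GRing.scale /=; ring.
Qed.

Lemma pair_ext {T U : Type} (a b : T * U) : a.1 = b.1 -> a.2 = b.2 -> a = b.
Proof. by case: a b => [? ?] [? ?] /= -> ->. Qed.

Definition cmul {R : realType} (a b : R * R) : R * R :=
  (a.1 * b.1 - a.2 * b.2, a.1 * b.2 + a.2 * b.1).

Definition cdiv {R : realType} (a b : R * R) : R * R :=
  ((a.1 * b.1 + a.2 * b.2) / (b.1 ^+ 2 + b.2 ^+ 2),
   (a.2 * b.1 - a.1 * b.2) / (b.1 ^+ 2 + b.2 ^+ 2)).

Definition conjz {R : realType} (a : R * R) : R * R := (a.1, - a.2).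

Definition mobius {R : realType} (w z : R * R) : R * R :=
  cdiv (z + w) ((1, 0) + cmul (conjz w) z).

(** Along a real line the quotient (P + s U)/(Q + s V) has derivative (U Q - P V)/(Q + s V)^2 with
    constant numerator. Hence its velocity at 0 is A and its acceleration B = -2 A V / Q. *)
Lemma has_derive2_homography {R : realType} (D : set (R * R)) (h : R * R -> R)
  (P Q U V : R * R) :
  harmonic_on D h ->
  (\forall s \near (0 : R), D (cdiv (P + s *: U) (Q + s *: V))) ->
  (\forall s \near (0 : R), (Q.1 + s * V.1) ^+ 2 + (Q.2 + s * V.2) ^+ 2 != 0) ->
  let A := cdiv (cmul U Q - cmul P V) (cmul Q Q) in
  let B := cmul (-2, 0) (cdiv (cmul A V) Q) in
  let p := cdiv P Q in
  is_derive (0 : R) 1 (fun s => h (cdiv (P + s *: U) (Q + s *: V)))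
    (A.1 * 'D_(e_x R) h p + A.2 * 'D_(e_y R) h p) /\
  has_derive2 (fun s => h (cdiv (P + s *: U) (Q + s *: V)))
    (B.1 * 'D_(e_x R) h p + B.2 * 'D_(e_y R) h p +
     (A.1 ^+ 2 * 'D_(e_x R) ('D_(e_x R) h) p + A.2 ^+ 2 * 'D_(e_y R) ('D_(e_y R) h) p +
      A.1 * A.2 * ('D_(e_y R) ('D_(e_x R) h) p + 'D_(e_x R) ('D_(e_y R) h) p))).
Proof.
move=> hh nD nQ A B p.
have lin (a b s : R) : is_derive s 1 (fun t => a + t * b) b.
  by apply: is_derive_eq; rewrite /GRing.scale /=; ring.
pose N1 t := P.1 + t * U.1; pose N2 t := P.2 + t * U.2.
pose D1 t := Q.1 + t * V.1; pose D2 t := Q.2 + t * V.2.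
pose X t := (N1 t * D1 t + N2 t * D2 t) / (D1 t ^+ 2 + D2 t ^+ 2).
pose Y t := (N2 t * D1 t - N1 t * D2 t) / (D1 t ^+ 2 + D2 t ^+ 2).
pose E := cmul U Q - cmul P V.
pose S1 t := D1 t ^+ 2 - D2 t ^+ 2; pose S2 t := 2 * D1 t * D2 t.
pose X1 t := (E.1 * S1 t + E.2 * S2 t) / (S1 t ^+ 2 + S2 t ^+ 2).
pose Y1 t := (E.2 * S1 t - E.1 * S2 t) / (S1 t ^+ 2 + S2 t ^+ 2).
have hX : \forall s \near (0 : R), is_derive (s : R) 1 X (X1 s).
  apply: filterS nQ => s Qs.
  have := is_derive_cdiv1 (lin P.1 U.1 s) (lin P.2 U.2 s) (lin Q.1 V.1 s) (lin Q.2 V.2 s) Qs.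
  move=> H; apply: is_derive_eq; rewrite /X1 /S1 /S2 /D1 /D2 /E /=; congr (_ / _); ring.
have hY : \forall s \near (0 : R), is_derive (s : R) 1 Y (Y1 s).
  apply: filterS nQ => s Qs.
  have := is_derive_cdiv2 (lin P.1 U.1 s) (lin P.2 U.2 s) (lin Q.1 V.1 s) (lin Q.2 V.2 s) Qs.
  move=> H; apply: is_derive_eq; rewrite /Y1 /S1 /S2 /D1 /D2 /E /=; congr (_ / _); ring.
have Q0 : Q.1 ^+ 2 + Q.2 ^+ 2 != 0.
  by have := nbhs_singleton nQ; rewrite !mul0r !addr0.
have D10 : D1 0 = Q.1 by rewrite /D1; ring.
have D20 : D2 0 = Q.2 by rewrite /D2; ring.
have S0 : S1 0 ^+ 2 + S2 0 ^+ 2 != 0.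
  rewrite /S1 /S2 D10 D20 (_ : _ + _ = (Q.1 ^+ 2 + Q.2 ^+ 2) ^+ 2); first by rewrite expf_neq0.
  by ring.
have hS1 : is_derive (0 : R) 1 S1 (2 * (Q.1 * V.1 - Q.2 * V.2)).
  have l1 : is_derive (0 : R) 1 D1 V.1 := lin Q.1 V.1 0.
  have l2 : is_derive (0 : R) 1 D2 V.2 := lin Q.2 V.2 0.
  by apply: is_derive_eq; rewrite /GRing.scale /= ?D10 ?D20; ring.
have hS2 : is_derive (0 : R) 1 S2 (2 * (Q.1 * V.2 + Q.2 * V.1)).
  have l1 : is_derive (0 : R) 1 D1 V.1 := lin Q.1 V.1 0.
  have l2 : is_derive (0 : R) 1 D2 V.2 := lin Q.2 V.2 0.
  by apply: is_derive_eq; rewrite /GRing.scale /= ?D10 ?D20; ring.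
have hc (a : R) : is_derive (0 : R) 1 (fun _ : R => a) 0 by exact: is_derive_cst.
have den : [&& Q.1 ^+ 2 + Q.2 ^+ 2 != 0,
       (Q.1 * Q.1 - Q.2 * Q.2) ^+ 2 + (Q.1 * Q.2 + Q.2 * Q.1) ^+ 2 != 0
     & ((Q.1 ^+ 2 - Q.2 ^+ 2) ^+ 2 - (2 * Q.1 * Q.2) ^+ 2) ^+ 2 +
       (2 * (Q.1 ^+ 2 - Q.2 ^+ 2) * (2 * Q.1 * Q.2)) ^+ 2 != 0].
  apply/and3P; split => //.
    by apply: contra_neq (expf_neq0 2 Q0) => H; rewrite -[RHS]H; ring.
  by apply: contra_neq (expf_neq0 4 Q0) => H; rewrite -[RHS]H; ring.
have hX1 : is_derive (0 : R) 1 X1 B.1.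
  have := is_derive_cdiv1 (hc E.1) (hc E.2) hS1 hS2 S0.
  move=> H; apply: is_derive_eq; rewrite /B /A -/E /S1 /S2 D10 D20 /=.
  by field; exact: den.
have hY1 : is_derive (0 : R) 1 Y1 B.2.
  have := is_derive_cdiv2 (hc E.1) (hc E.2) hS1 hS2 S0.
  move=> H; apply: is_derive_eq; rewrite /B /A -/E /S1 /S2 D10 D20 /=.
  by field; exact: den.
have XY s : cdiv (P + s *: U) (Q + s *: V) = (X s, Y s) by [].
have X10 : X1 0 = A.1 by rewrite /X1 /A /S1 /S2 D10 D20 /cdiv /= -/E; congr (_ / _); ring.
have Y10 : Y1 0 = A.2 by rewrite /Y1 /A /S1 /S2 D10 D20 /cdiv /= -/E; congr (_ / _); ring.
have p0 : (X 0, Y 0) = p by rewrite -XY !scale0r !addr0.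
rewrite (_ : (fun s => _) = (fun s => h (X s, Y s))) //; split.
  rewrite -X10 -Y10 -p0; apply: is_derive_curve.
  - by have [] := hh _ (nbhs_singleton nD); rewrite XY.
  - exact: nbhs_singleton hX.
  - exact: nbhs_singleton hY.
rewrite -X10 -Y10 -p0; exact: (has_derive2_curve hh nD hX hY hX1 hY1).
Qed.

Definition normsq {R : realType} (z : R * R) : R := z.1 ^+ 2 + z.2 ^+ 2.

Lemma normsq_cmul {R : realType} (a b : R * R) : normsq (cmul a b) = normsq a * normsq b.
Proof. by rewrite /normsq /cmul /=; ring. Qed.

Lemma udisc_cmul {R : realType} (e z : R * R) : normsq e = 1 -> udisc z -> udisc (cmul e z).
Proof. by rewrite /udisc /= => e1 zD; have := normsq_cmul e z; rewrite e1 mul1r /normsq => ->. Qed.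

Lemma normsq_cdiv {R : realType} (a b : R * R) : normsq b != 0 ->
  normsq (cdiv a b) = normsq a / normsq b.
Proof.
case: a b => [a1 a2] [b1 b2]; rewrite /normsq /cdiv /= => b0.
by field.
Qed.

Lemma open_udisc {R : realType} (z : R * R) : udisc z -> \forall w \near z, udisc w.
Proof.
move=> zD.
have c : {for z, continuous (fun w : R * R => w.1 * w.1 + w.2 * w.2)}.
  have c1 : {for z, continuous (fun w : R * R => w.1)} by exact: cvg_fst.
  have c2 : {for z, continuous (fun w : R * R => w.2)} by exact: cvg_snd.
  exact: (continuousD (continuousM c1 c1) (continuousM c2 c2)).
have : \forall w \near z, w.1 * w.1 + w.2 * w.2 < 1.
  by apply: (cvgr_lt _ c); rewrite -!expr2.
by apply: filterS => w; rewrite -!expr2.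
Qed.

(** The identity |1 + conj(w) z|^2 = |z + w|^2 + (1 - |w|^2)(1 - |z|^2) shows that the denominator
    is nonzero and, in the next lemma, that the quotient has modulus below 1. *)
Lemma mobius_den {R : realType} (w z : R * R) : udisc w -> udisc z ->
  normsq ((1, 0) + cmul (conjz w) z) != 0.
Proof.
rewrite /udisc /= => wD zD; apply/eqP => H.
have E : normsq (z + w) + (1 - normsq w) * (1 - normsq z) = normsq ((1, 0) + cmul (conjz w) z).
  by rewrite /normsq /=; ring.
have : 0 < (1 - normsq w) * (1 - normsq z) by rewrite mulr_gt0 // subr_gt0.
have : 0 <= normsq (z + w) by rewrite addr_ge0 ?sqr_ge0.
by rewrite H in E; lra.
Qed.

Lemma mobius_udisc {R : realType} (w z : R * R) : udisc w -> udisc z -> udisc (mobius w z).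
Proof.
move=> wD zD; have Q0 := mobius_den wD zD.
have E : normsq (z + w) + (1 - normsq w) * (1 - normsq z) = normsq ((1, 0) + cmul (conjz w) z).
  by rewrite /normsq /=; ring.
have p : 0 < (1 - normsq w) * (1 - normsq z) by rewrite mulr_gt0 // subr_gt0.
rewrite /udisc /mobius /=; set P := z + w in E *; set Q := _ + cmul _ _ in E Q0 *.
have Qp : 0 < normsq Q by rewrite lt_neqAle eq_sym Q0 addr_ge0 ?sqr_ge0.
rewrite -/(normsq (cdiv P Q)) normsq_cdiv //.
by rewrite ltr_pdivrMr // mul1r; lra.
Qed.

Section MobiusComposition.
Variables (R : realType) (h : R * R -> R) (w e : R * R).
Hypothesis hh : harmonic_on (@udisc R) h.
Hypothesis wD : udisc w.
Hypothesis e1 : normsq e = 1.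

Let f z := h (mobius w (cmul e z)).

Let line (z v : R * R) (s : R) : mobius w (cmul e (z + s *: v)) =
  cdiv ((cmul e z + w) + s *: cmul e v)
       (((1, 0) + cmul (conjz w) (cmul e z)) + s *: cmul (conjz w) (cmul e v)).
Proof.
rewrite /mobius; congr (cdiv _ _); apply: pair_ext;
  rewrite /= /GRing.scale /=; ring.
Qed.

Let near_lineD (z v : R * R) : udisc z -> \forall s \near (0 : R), udisc (z + s *: v).
Proof.
move=> zD; have c : (z + s *: v) @[s --> (0 : R)] --> z + 0 *: v.
  by apply: cvgD; [exact: cvg_cst|apply: cvgZr_tmp; exact: cvg_id].
by rewrite scale0r addr0 in c; exact: (c _ (open_udisc zD)).
Qed.

Let homD (z v : R * R) : udisc z -> \forall s \near (0 : R),
  udisc (cdiv ((cmul e z + w) + s *: cmul e v)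
       (((1, 0) + cmul (conjz w) (cmul e z)) + s *: cmul (conjz w) (cmul e v))).
Proof.
move=> zD; apply: filterS (near_lineD v zD) => s sD.
by rewrite -line; apply: mobius_udisc => //; exact: udisc_cmul.
Qed.

Let homQ (z v : R * R) : udisc z -> let Q := (1, 0) + cmul (conjz w) (cmul e z) in
  let V := cmul (conjz w) (cmul e v) in
  \forall s \near (0 : R), (Q.1 + s * V.1) ^+ 2 + (Q.2 + s * V.2) ^+ 2 != 0.
Proof.
move=> zD Q V; apply: filterS (near_lineD v zD) => s sD.
have := mobius_den wD (udisc_cmul e1 sD); congr (_ != 0).
by rewrite /normsq /Q /V /= /GRing.scale /=; ring.
Qed.

(** The factor 1 - |w|^2 is the derivative of the automorphism at 0; it is real and positive, so
    directions are turned by e only. *)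
Lemma is_derive_mobius (v : R * R) :
  is_derive (0 : R) 1 (fun s => f (s *: v))
    ((1 - normsq w) * ((cmul e v).1 * 'D_(e_x R) h w + (cmul e v).2 * 'D_(e_y R) h w)).
Proof.
have D0 : udisc (0 : R * R) by rewrite /udisc /= !expr0n /= addr0.
have c0 (a : R * R) : cmul a 0 = 0 by apply: pair_ext; rewrite /= !mulr0 ?subr0 ?addr0.
have [H _] := has_derive2_homography hh (homD v D0) (homQ v D0).
rewrite (_ : (fun s => f (s *: v)) = (fun s => h (cdiv ((cmul e 0 + w) + s *: cmul e v)
       (((1, 0) + cmul (conjz w) (cmul e 0)) + s *: cmul (conjz w) (cmul e v))))); last first.
  by apply/funext => s; rewrite /f -line add0r.
apply: is_derive_eq; rewrite !c0 add0r addr0.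
have E1 (a : R * R) : cdiv a (1, 0) = a.
  by apply: pair_ext; rewrite /= ?expr0n /= ?mulr0 ?addr0 ?subr0 expr1n divr1 ?mulr1.
have E2 : cmul (1, 0) (1, 0) = (1, 0) :> R * R by apply: pair_ext => /=; ring.
by rewrite E2 !E1 /cmul /normsq /=; ring.
Qed.

(** The directions 1 and i have velocities A and i A and accelerations B and -B. In the sum the
    first-order terms and the mixed partials cancel, leaving |A|^2 times the Laplacian of h. *)
Lemma laplacian_at_mobius (z : R * R) : udisc z -> laplacian_at f z 0.
Proof.
move=> zD.
have hD v := has_derive2_homography hh (homD v zD) (homQ v zD).
have [_ Hx] := hD (1, 0); have [_ Hy] := hD (0, 1).
eexists; eexists; split.
- rewrite (_ : (fun s => _) = (fun s => h (cdiv ((cmul e z + w) + s *: cmul e (1, 0))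
       (((1, 0) + cmul (conjz w) (cmul e z)) + s *: cmul (conjz w) (cmul e (1, 0)))))).
    exact: Hx.
  apply/funext => s; rewrite /f -line; congr (h (mobius w (cmul e _))).
  by apply: pair_ext; rewrite /= /GRing.scale /= ?mulr1 ?mulr0 ?addr0.
- rewrite (_ : (fun s => _) = (fun s => h (cdiv ((cmul e z + w) + s *: cmul e (0, 1))
       (((1, 0) + cmul (conjz w) (cmul e z)) + s *: cmul (conjz w) (cmul e (0, 1)))))).
    exact: Hy.
  apply/funext => s; rewrite /f -line; congr (h (mobius w (cmul e _))).
  by apply: pair_ext; rewrite /= /GRing.scale /= ?mulr1 ?mulr0 ?addr0.
set P := cmul e z + w; set Q := (1, 0) + _.
have hp : udisc (cdiv P Q) by apply: mobius_udisc => //; exact: udisc_cmul.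
have [_ _ _ L] := hh hp.
have iU : cmul e (0, 1) = cmul (0, 1) (cmul e (1, 0)).
  by apply: pair_ext => /=; ring.
have iV : cmul (conjz w) (cmul (0, 1) (cmul e (1, 0))) =
    cmul (0, 1) (cmul (conjz w) (cmul e (1, 0))).
  by apply: pair_ext => /=; ring.
have cdivM (a b c : R * R) : cdiv (cmul a b) c = cmul a (cdiv b c).
  by apply: pair_ext; rewrite /=; set i := _^-1; ring.
have cmul_i (a b c d : R * R) :
    cmul (cmul (0, 1) a) b - cmul c (cmul (0, 1) d) = cmul (0, 1) (cmul a b - cmul c d).
  by apply: pair_ext => /=; ring.
have cmul_ii (a b : R * R) : cmul (cmul (0, 1) a) (cmul (0, 1) b) = cmul (-1, 0) (cmul a b).
  by apply: pair_ext => /=; ring.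
rewrite iU iV cmul_i (cdivM (0, 1)); set A := cdiv (cmul _ Q - _) _.
rewrite cmul_ii (cdivM (-1, 0)); set B := cdiv (cmul A _) Q; clearbody B; clearbody A.
move: L; set p := cdiv P Q; clearbody p.
generalize ('D_(e_x R) ('D_(e_x R) h) p) ('D_(e_y R) ('D_(e_y R) h) p).
generalize ('D_(e_y R) ('D_(e_x R) h) p) ('D_(e_x R) ('D_(e_y R) h) p).
generalize ('D_(e_x R) h p) ('D_(e_y R) h p) => hx hy hyx hxy hxx hyy L.
apply: (@eq_trans _ _ ((A.1 ^+ 2 + A.2 ^+ 2) * (hxx + hyy))); last by rewrite L mulr0.
by rewrite /=; ring.
Qed.

End MobiusComposition.

(** * Averages over roots of unity *)

Lemma segment_unif_continuous {R : realType} (g : R -> R) (a b : R) :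
  (forall x, {for x, continuous g}) -> forall e, 0 < e ->
  exists2 d : R, 0 < d & forall x s, a <= x -> x <= b -> `|s| < d -> `|g (x + s) - g x| <= e.
Proof.
move=> gc e e0.
have /compact_near_coveringP H := @segment_compact R a b.
have [|d d0 {}H] := near_at0P (H _ (nbhs (0 : R)) (fun s x => `|g (x + s) - g x| <= e) _ _).
  move=> x _.
  have /cvgrPdist_le/(_ (e / 2) ltac:(by rewrite divr_gt0)) := gc x.
  move=> /nbhs_ballP[d /= d0 gd].
  have d20 : 0 < d / 2 by rewrite divr_gt0.
  exists (ball x (d / 2), ball (0 : R) (d / 2)); first by split => /=; exact: nbhsx_ballx.
  move=> [y s] [/= yx]; rewrite /ball /= sub0r normrN in yx * => sd.
  have h1 := gd y; have h2 := gd (y + s).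
  rewrite /ball /= in h1 h2.
  have {}h1 : `|g x - g y| <= e / 2 by apply: h1; lra.
  have {}h2 : `|g x - g (y + s)| <= e / 2.
    by apply: h2; rewrite opprD addrA (le_lt_trans (ler_normB _ _)) //; lra.
  have -> : g (y + s) - g y = (g x - g y) - (g x - g (y + s)) by ring.
  by apply: le_trans (ler_normB _ _) _; lra.
exists d => // x s ax xb sd; apply: (H s sd x).
by rewrite /= in_itv /= ax xb.
Qed.

Lemma segment_bounded {R : realType} (g : R -> R) (a b : R) :
  (forall x, {for x, continuous g}) ->
  exists2 B : R, 0 <= B & forall x, a <= x -> x <= b -> `|g x| <= B.
Proof.
move=> gc; have [ab|ba] := lerP a b; last by exists 0 => // x ax xb; lra.
have [c _ cP] : exists2 c, c \in `[a, b] & forall t, t \in `[a, b] -> `|g t| <= `|g c|.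
  apply: (@EVT_max _ (fun x => `|g x|)) => //; apply: continuous_subspaceT => x.
  by apply: (@continuous_comp _ _ _ g (fun x : R => `|x|)); [exact: gc|exact: norm_continuous].
by exists `|g c| => // x ax xb; apply: cP; rewrite in_itv /= ax xb.
Qed.

Definition cis {R : realType} (t : R) : R * R := (cos t, sin t).

Lemma normsq_cis {R : realType} (t : R) : normsq (cis t) = 1.
Proof. exact: cos2Dsin2. Qed.

Lemma cmul_cis {R : realType} (s t : R) : cmul (cis s) (cis t) = cis (s + t).
Proof. by rewrite /cis cosD sinD /cmul /=; congr (_, _); rewrite addrC. Qed.

Lemma cmulZr {R : realType} (r : R) (a b : R * R) : cmul a (r *: b) = r *: cmul a b.
Proof. by apply: pair_ext; rewrite /= /GRing.scale /=; ring. Qed.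

Lemma polar {R : realType} (z : R * R) (r : R) : 0 < r -> normsq z = r ^+ 2 ->
  exists t, [/\ 0 <= t, t <= 2 * pi & z = r *: cis t].
Proof.
move=> r0 zr.
have r0' : r != 0 by rewrite gt_eqF.
pose x := z.1 / r; pose y := z.2 / r.
have xy : x ^+ 2 + y ^+ 2 = 1.
  by rewrite /x /y !expr_div_n -mulrDl; move: zr; rewrite /normsq => ->; rewrite divff // expf_neq0.
have x1 : -1 <= x <= 1 by apply/andP; have := sqr_ge0 y; split; nra.
have zE : z = r *: (x, y).
  by apply: pair_ext; rewrite /= /GRing.scale /= mulrC divfK.
have cx := acosK x1; have sx := sin_acos x1.
have y2 : `|y| = Num.sqrt (1 - x ^+ 2) by rewrite -sqrtr_sqr; congr (Num.sqrt _); lra.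
have pi0 := pi_gt0 R.
have a0 := acos_ge0 x1; have api := acos_lepi x1.
have [y0|y0] := lerP 0 y.
  exists (acos x); split => //; first lra.
  by rewrite zE /cis cx sx -y2 ger0_norm.
exists (2 * pi - acos x); split; [lra|lra|].
have -> : 2 * pi - acos x = - acos x + pi *+ 2 by rewrite mulr_natl addrC.
rewrite zE /cis cosD2pi sinD2pi cosN sinN cx sx -y2 ltr0_norm // opprK //.
Qed.

Definition avg {R : realType} (N : nat) (g : R -> R) : R :=
  (\sum_(0 <= j < N) g (j%:R * (2 * pi / N%:R))) / N%:R.

Section Averages.
Variables (R : realType) (N : nat).
Hypothesis N0 : (0 < N)%N.
Implicit Types (g h : R -> R) (k a : R).

Lemma avgD g h : avg N (fun t => g t + h t) = avg N g + avg N h.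
Proof. by rewrite /avg big_split mulrDl. Qed.

Lemma avgZ k g : avg N (fun t => k * g t) = k * avg N g.
Proof. by rewrite /avg -mulr_sumr mulrA. Qed.

Lemma avg_cst k : avg N (fun=> k) = k.
Proof.
by rewrite /avg sumr_const_nat subn0 -[k *+ N]mulr_natr mulfK // pnatr_eq0 -lt0n.
Qed.

Lemma avg_eq g h : g =1 h -> avg N g = avg N h.
Proof. by move=> gh; rewrite (_ : g = h) //; apply/funext. Qed.

Lemma avg_le g h : (forall t, g t <= h t) -> avg N g <= avg N h.
Proof.
by move=> gh; rewrite ler_wpM2r ?invr_ge0 ?ler0n //; apply: ler_sum => j _; exact: gh.
Qed.

Lemma avg_norm_le g k :
  (forall j, (j < N)%N -> `|g (j%:R * (2 * pi / N%:R))| <= k) -> `|avg N g| <= k.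
Proof.
move=> H; have Np : 0 < N%:R :> R by rewrite ltr0n.
rewrite /avg normrM normfV (gtr0_norm Np) ler_pdivrMr //.
apply: le_trans (ler_norm_sum _ _ _) _.
apply: (@le_trans _ _ (\sum_(0 <= j < N) k)).
  by rewrite !big_seq; apply: ler_sum => j; rewrite mem_index_iota => /andP[_]; exact: H.
by rewrite sumr_const_nat subn0 mulr_natr.
Qed.

Lemma sum_periodic_shift (c : nat -> R) (k : nat) : (forall j, c (j + N)%N = c j) ->
  \sum_(0 <= j < N) c (j + k)%N = \sum_(0 <= j < N) c j.
Proof.
move=> cN; elim: k => [|k IH]; first by under eq_bigr do rewrite addn0.
rewrite -IH; case: (N) N0 cN => // n _ cN.
rewrite big_nat_recr //= [RHS]big_nat_recl //= addrC; congr (_ + _).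
  by rewrite ?add0n -(cN k); congr (c _); rewrite !addnS addnC.
by apply: eq_bigr => j _; rewrite addSnnS.
Qed.

Lemma avg_shift g (k : nat) : (forall t, g (t + 2 * pi) = g t) ->
  avg N (fun t => g (t + k%:R * (2 * pi / N%:R))) = avg N g.
Proof.
move=> gp; have N0' : N%:R != 0 :> R by rewrite pnatr_eq0 -lt0n.
rewrite /avg; congr (_ / _).
rewrite -(@sum_periodic_shift (fun j => g (j%:R * (2 * pi / N%:R))) k).
  by apply: eq_bigr => j _; rewrite -mulrDl -natrD.
move=> j; rewrite natrD mulrDl (_ : N%:R * _ = 2 * pi) ?gp //.
by rewrite mulrCA divff // mulr1.
Qed.

End Averages.

Section TrigonometricAverages.
Variables (R : realType) (M : nat).
Let N := (4 * M.+1)%N.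

Let N0 : (0 < N)%N. Proof. by []. Qed.

(** The number of nodes is divisible by 4 precisely so that a quarter turn permutes them. *)
Lemma avg_quarter_shift (g : R -> R) : (forall t, g (t + 2 * pi) = g t) ->
  avg N (fun t => g (t + pi / 2)) = avg N g.
Proof.
move=> gp; rewrite -(avg_shift N0 M.+1 gp); apply: avg_eq => t; congr (g (_ + _)).
have M0 : M.+1%:R != 0 :> R by rewrite pnatr_eq0.
by rewrite /N natrM; field; rewrite nat1r.
Qed.

Lemma cosDpi2 (t : R) : cos (t + 2 * pi) = cos t.
Proof. by rewrite mulr_natl cosD2pi. Qed.

Lemma sinDpi2 (t : R) : sin (t + 2 * pi) = sin t.
Proof. by rewrite mulr_natl sinD2pi. Qed.

(** A quarter turn sends (cos, sin) to (-sin, cos). It thus exchanges the two squares, whose sum is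
    1, and reverses the sign of the mixed product. *)
Lemma avg_cos_sin : [/\ avg N (@cos R) = 0, avg N (@sin R) = 0,
  avg N (fun t : R => cos t * cos t) = 1 / 2, avg N (fun t : R => sin t * sin t) = 1 / 2
  & avg N (fun t : R => cos t * sin t) = 0].
Proof.
have sc : avg N (@sin R) = avg N (@cos R).
  by rewrite -(avg_quarter_shift sinDpi2); apply: avg_eq => t; rewrite sinDpihalf.
have cs : avg N (@cos R) = - avg N (@sin R).
  rewrite -(avg_quarter_shift cosDpi2) -mulN1r -avgZ; apply: avg_eq => t.
  by rewrite cosDpihalf mulN1r.
have ss : avg N (fun t : R => sin t * sin t) = avg N (fun t : R => cos t * cos t).
  rewrite -(@avg_quarter_shift (fun t => sin t * sin t)).
    by apply: avg_eq => t; rewrite sinDpihalf.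
  by move=> t; rewrite sinDpi2.
have one : avg N (fun t : R => cos t * cos t) + avg N (fun t : R => sin t * sin t) = 1.
  rewrite -avgD -[RHS](avg_cst N0 1); apply: avg_eq => t.
  by rewrite -!expr2 cos2Dsin2.
have mixed : avg N (fun t : R => cos t * sin t) = - avg N (fun t : R => cos t * sin t).
  rewrite -{1}(@avg_quarter_shift (fun t => cos t * sin t)); last first.
    by move=> t; rewrite sinDpi2 cosDpi2.
  rewrite -mulN1r -avgZ; apply: avg_eq => t.
  by rewrite sinDpihalf cosDpihalf; ring.
by split; lra.
Qed.

End TrigonometricAverages.

Lemma norm_le_of_sqr {R : realType} (x a : R) : 0 <= a -> x ^+ 2 <= a ^+ 2 -> `|x| <= a.
Proof. by move=> a0 xa; rewrite -(@ler_pXn2r _ 2) ?nnegrE // real_normK // num_real. Qed.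

Lemma continuous_sum_nat {T : topologicalType} {R : realType} (F : nat -> T -> R) (n : nat)
  (z : T) : (forall j, {for z, continuous (F j)}) ->
  {for z, continuous (fun w => \sum_(0 <= j < n) F j w)}.
Proof.
by move=> Fc; apply: cvg_big => [|j _]; [exact: add_continuous|exact: Fc].
Qed.

Lemma is_derive_avg {R : realType} (N : nat) (F : R -> R -> R) (F' : R -> R) :
  (forall t, is_derive (0 : R) 1 (F t) (F' t)) ->
  is_derive (0 : R) 1 (fun s => avg N (fun t => F t s)) (avg N F').
Proof.
move=> FF; rewrite /avg; set h := _ / _.
rewrite (_ : (fun _ => _) = fun s => N%:R^-1 * \sum_(0 <= j < N) F (j%:R * h) s); last first.
  by apply/funext => s; rewrite mulrC.
rewrite mulrC; apply: is_deriveZ; move: h => h; elim: N => [|n IH].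
  rewrite big_nil (_ : (fun _ => _) = fun=> 0); first exact: is_derive_cst.
  by apply/funext => s; rewrite big_nil.
rewrite big_nat_recr //= (_ : (fun _ => _) =
  fun s => \sum_(0 <= j < n) F (j%:R * h) s + F (n%:R * h) s); first exact: is_deriveD.
by apply/funext => s; rewrite big_nat_recr.
Qed.

(** * Circle moments of a harmonic function against a weight of degree one *)

Section TrigonometricMoment.
Variables (R : realType) (f : R * R -> R) (fx fy r c0 c1 c2 : R).
Hypotheses (r0 : 0 < r) (r1 : r < 1).
Hypothesis fc : forall z, udisc z -> {for z, continuous f}.
(** Required for every rotate of f, because [laplacian_at] only looks along the coordinate lines and
    the proof sums rotates of f. *)
Hypothesis fL : forall e z, normsq e = 1 -> udisc z ->
  laplacian_at (fun z => f (cmul e z)) z 0.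
Hypothesis fd : forall e, normsq e = 1 ->
  is_derive (0 : R) 1 (fun s => f (s *: e)) (e.1 * fx + e.2 * fy).

Let k (t : R) : R := c0 + c1 * cos t + c2 * sin t.
Let g (t : R) : R := f (r *: cis t).

Let normsqZ (a : R) (z : R * R) : normsq (a *: z) = a ^+ 2 * normsq z.
Proof. by rewrite /normsq /= /GRing.scale /=; ring. Qed.

Let r_disc (z : R * R) : normsq z <= r ^+ 2 -> udisc z.
Proof. by rewrite /udisc /normsq /= => /le_lt_trans; apply; rewrite expr_lt1 // ltW. Qed.

Let kc (t : R) : {for t, continuous k}.
Proof.
apply: continuousD.
  apply: continuousD; first exact: cst_continuous.
  by apply: continuousM; [exact: cst_continuous|exact: continuous_cos].
by apply: continuousM; [exact: cst_continuous|exact: continuous_sin].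
Qed.

Let gc (t : R) : {for t, continuous g}.
Proof.
apply: (@continuous_comp _ _ _ (fun t : R => r *: cis t) f); last first.
  by apply: fc; apply: r_disc; rewrite normsqZ normsq_cis mulr1.
have c' : {for t, continuous (fun t : R => r * cos t)}.
  by apply: continuousM; [exact: cst_continuous|exact: continuous_cos].
have s' : {for t, continuous (fun t : R => r * sin t)}.
  by apply: continuousM; [exact: cst_continuous|exact: continuous_sin].
exact: (cvg_pair c' s').
Qed.

Let kp (t : R) : k (t + 2 * pi) = k t.
Proof. by rewrite /k cosDpi2 sinDpi2. Qed.

Let gp (t : R) : g (t + 2 * pi) = g t.
Proof. by rewrite /g /cis cosDpi2 sinDpi2. Qed.

Let C0 N := avg N (fun t => c0 * g t).
Let C1 N := avg N (fun t => (c1 * cos t + c2 * sin t) * g t).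
Let C2 N := avg N (fun t => (c1 * sin t - c2 * cos t) * g t).

(** Translates of a degree-one weight span only 1, cos and sin, so the discrete convolution is
    exactly of degree one in tau. *)
Let avg_conv N (tau : R) :
  C0 N + C1 N * cos tau + C2 N * sin tau = avg N (fun t => k (t - tau) * g t).
Proof.
rewrite /C0 /C1 /C2 [X in _ + X + _]mulrC [X in _ + X]mulrC -!avgZ -!avgD.
by apply: avg_eq => t; rewrite /k cosB sinB; ring.
Qed.

(* Equality holds when [tau] is a multiple of [2 pi / N], by reindexing the sum;
   uniform continuity covers the remaining angles. *)
Let circle_approx (eta : R) : 0 < eta -> exists M0, forall M, (M0 <= M)%N ->
  let N := (4 * M.+1)%N in forall tau : R, 0 <= tau -> tau <= 2 * pi ->
  `|avg N (fun t => k t * g (t + tau)) - (C0 N + C1 N * cos tau + C2 N * sin tau)| <= eta.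
Proof.
move=> eta0.
(* A node and a shift are each at most 2 pi, so their sum stays below 4 pi. *)
have [K K0 kK] := @segment_bounded _ k 0 (4 * pi) kc.
have [B B0 gB] := @segment_bounded _ g 0 (4 * pi) gc.
pose eta1 := eta / (K + B + 1); have KB : 0 < K + B + 1 by lra.
have eta10 : 0 < eta1 by rewrite divr_gt0.
have [d d0 kd] := @segment_unif_continuous _ k 0 (4 * pi) kc _ eta10.
have [d' d'0 gd] := @segment_unif_continuous _ g 0 (4 * pi) gc _ eta10.
pose m := Num.min d d'; have m0 : 0 < m by rewrite lt_min d0.
have [md md'] : m <= d /\ m <= d' by rewrite !ge_min !lexx orbT.
have pi0 := pi_gt0 R.
exists (Num.truncn (2 * pi / m)) => M MM0 N tau tau0 tau2.
have q0 : 0 <= 2 * pi / m by rewrite divr_ge0 // ltW // mulr_gt0.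
have /andP[_ Mlt] := truncn_itv q0.
have N0 : (0 < N)%N by [].
have Np : 0 < N%:R :> R by rewrite ltr0n.
pose h : R := 2 * pi / N%:R.
have h0 : 0 < h by rewrite divr_gt0 // mulr_gt0.
have Nh : N%:R * h = 2 * pi by rewrite /h mulrC divfK // gt_eqF.
have hm : h < m.
  rewrite /h ltr_pdivrMr // -ltr_pdivrMl // mulrC.
  apply: lt_le_trans Mlt _; rewrite ler_nat; exact: (leq_trans MM0 (leq_pmull M.+1 (isT : (0 < 4)%N))).
have t0 : 0 <= tau / h by rewrite divr_ge0 // ltW.
have /andP[j1 j2] := truncn_itv t0; set j := Num.truncn _ in j1 j2.
(* The multiple j h of the mesh permutes the nodes; only the remainder s, smaller than the mesh,
   causes an error. *)
pose s := tau - j%:R * h.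
have s0 : 0 <= s by rewrite subr_ge0 -ler_pdivlMr.
have sh : s < h by move: j2; rewrite ltr_pdivrMr // -natr1 /s; lra.
have per (t : R) : k (t + 2 * pi - tau) * g (t + 2 * pi) = k (t - tau) * g t.
  by rewrite gp addrAC kp.
rewrite avg_conv -(avg_shift N0 j per) -/h -[X in _ - X]mul1r -mulNr -avgZ -avgD.
have -> : eta = eta1 * (K + B + 1) by rewrite /eta1 divfK // gt_eqF.
apply: avg_norm_le => // i iN; rewrite -/h; set t := i%:R * h.
have ta : 0 <= t by rewrite mulr_ge0 // ltW.
have tb : t <= 2 * pi by rewrite -Nh /t ler_pM2r // ler_nat ltnW.
have jt : j%:R * h <= tau by rewrite -subr_ge0.
have j0 : 0 <= j%:R * h by rewrite mulr_ge0 // ltW.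
have -> : t + tau = t + j%:R * h + s by rewrite /s; ring.
have -> : t + j%:R * h - tau = t + - s by rewrite /s; ring.
set u := t + j%:R * h.
have sm : `|s| < m by rewrite ger0_norm //; lra.
have E1 := gd u s ltac:(rewrite /u; lra) ltac:(rewrite /u; lra) ltac:(lra).
have E2 := kd t (- s) ltac:(lra) ltac:(lra) ltac:(rewrite normrN; lra).
have E3 := kK t ltac:(lra) ltac:(lra).
have E4 := gB u ltac:(rewrite /u; lra) ltac:(rewrite /u; lra).
have -> : k t * g (u + s) + -1 * (k (t + - s) * g u) =
  k t * (g (u + s) - g u) - (k (t + - s) - k t) * g u by ring.
apply: le_trans (ler_normB _ _) _; rewrite !normrM.
have F1 : `|k t| * `|g (u + s) - g u| <= K * eta1 by apply: ler_pM.
have F2 : `|k (t + - s) - k t| * `|g u| <= eta1 * B by apply: ler_pM.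
by lra.
Qed.

(** Extends the discrete convolution from the circle to the disc as a finite combination of rotates
    of f, hence a harmonic function. *)
Let H N (z : R * R) := avg N (fun t => k t * f (cmul (cis t) z)).

Let H_circle N tau : H N (r *: cis tau) = avg N (fun t => k t * g (t + tau)).
Proof. by apply: avg_eq => t; rewrite cmulZr cmul_cis. Qed.

Let HL N z : udisc z -> laplacian_at (H N) z 0.
Proof.
move=> zD; rewrite (_ : H N = fun z => N%:R^-1 * \sum_(0 <= j < N)
    (k (j%:R * (2 * pi / N%:R)) * f (cmul (cis (j%:R * (2 * pi / N%:R))) z))); last first.
  by apply/funext => w; rewrite /H /avg mulrC.
have L j : laplacian_at (fun w => k (j%:R * (2 * pi / N%:R)) *
    f (cmul (cis (j%:R * (2 * pi / N%:R))) w)) z 0.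
  by have := laplacian_atZ (k (j%:R * (2 * pi / N%:R))) (fL (normsq_cis (j%:R * (2 * pi / N%:R))) zD);
    rewrite mulr0.
by have := laplacian_atZ N%:R^-1 (laplacian_at_sum N L); rewrite mulr0.
Qed.

Let Hc N z : udisc z -> {for z, continuous (H N)}.
Proof.
move=> zD; apply: continuousM; last exact: cst_continuous.
apply: (@continuous_sum_nat _ _
  (fun j w => k (j%:R * (2 * pi / N%:R)) * f (cmul (cis (j%:R * (2 * pi / N%:R))) w))) => j; set t := _ * _.
apply: continuousM; first exact: cst_continuous.
apply: (@continuous_comp _ _ _ (cmul (cis t)) f).
  have z1 : {for z, continuous (fun w : R * R => w.1)} by exact: cvg_fst.
  have z2 : {for z, continuous (fun w : R * R => w.2)} by exact: cvg_snd.
  have cc (a : R) : {for z, continuous (fun _ : R * R => a)} by exact: cst_continuous.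
  exact: (cvg_pair (continuousB (continuousM (cc _) z1) (continuousM (cc _) z2))
    (continuousD (continuousM (cc _) z2) (continuousM (cc _) z1))).
by apply: fc; apply: udisc_cmul => //; exact: normsq_cis.
Qed.

(* On the circle of radius [r], the harmonic function [H N] is close to an affine
   function; by the maximum principle it is so on the whole disc, and its value
   and first derivative at [0] are computed exactly. *)
Lemma trig_moment (eps : R) : 0 < eps -> exists M0, forall M, (M0 <= M)%N ->
  `|avg (4 * M.+1) (fun t => (c0 + c1 * cos t + c2 * sin t) * f (r *: cis t)) -
    (c0 * f 0 + r / 2 * (c1 * fx + c2 * fy))| <= eps.
Proof.
(* One fifth is spent on the value at 0 and four on the derivative, which is bounded by 2 eta /
   (r/2) and multiplied by r. *)
move=> eps0; have eta0 : 0 < eps / 5 by rewrite divr_gt0.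
have [M0 HM0] := circle_approx eta0; exists M0 => M /HM0 {HM0}.
set N := (4 * M.+1)%N => /= approx; set eta := eps / 5 in eta0 approx.
have r0' : r != 0 by rewrite gt_eqF.
have [a1 a2 a3 a4 a5] := @avg_cos_sin R M.
have ell (z : R * R) : laplacian_at (fun z => - (C0 N + (C1 N / r) * z.1 + (C2 N / r) * z.2)) z 0.
  rewrite (_ : (fun _ => _) = fun z : R * R => - C0 N + (- (C1 N / r)) * z.1 +
    (- (C2 N / r)) * z.2 + 0 * z.1 ^+ 2 + 0 * z.2 ^+ 2).
    by have := laplacian_at_quad (- C0 N) (- (C1 N / r)) (- (C2 N / r)) 0 0 z; rewrite mulr0 addr0.
  by apply/funext => w; ring.
pose E (z : R * R) := H N z + - (C0 N + (C1 N / r) * z.1 + (C2 N / r) * z.2).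
have EL z : udisc z -> laplacian_at E z 0.
  by move=> zD; have := laplacian_atD (@HL N z zD) (ell z); rewrite addr0.
have Ec z : udisc z -> {for z, continuous E}.
  move=> zD; have z1 : {for z, continuous (fun w : R * R => w.1)} by exact: cvg_fst.
  have z2 : {for z, continuous (fun w : R * R => w.2)} by exact: cvg_snd.
  have cc (a : R) : {for z, continuous (fun _ : R * R => a)} by exact: cst_continuous.
  have cl : {for z, continuous (fun w : R * R => C0 N + (C1 N / r) * w.1 + (C2 N / r) * w.2)}.
    exact: (continuousD (continuousD (cc _) (continuousM (cc _) z1)) (continuousM (cc _) z2)).
  exact: (continuousB (@Hc N z zD) cl).
have Ecirc z : normsq z = r ^+ 2 -> `|E z| <= eta.
  move=> zr; have [tau [t0 t2 ->]] := polar r0 zr.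
  rewrite /E H_circle; have := approx tau t0 t2; congr (`|_ + - _| <= _).
  by rewrite /= /GRing.scale /=; field.
pose K : set (R * R) := [set z | normsq z <= r ^+ 2].
have nc : continuous (@normsq R).
  move=> z; have z1 : {for z, continuous (fun w : R * R => w.1)} by exact: cvg_fst.
  have z2 : {for z, continuous (fun w : R * R => w.2)} by exact: cvg_snd.
  exact: (continuousD (continuousM z1 z1) (continuousM z2 z2)).
have cK : compact K.
  apply: (@subclosed_compact _ _ (`[- r, r] `*` `[- r, r])).
  - have -> : K = @normsq R @^-1` [set x | x <= r ^+ 2] by [].
    by apply: closed_comp => //; exact: closed_le.
  - by apply: compact_setX; exact: segment_compact.
  - move=> z /=; rewrite /K /normsq /= => zK; rewrite !in_itv /=.
    have p1 := sqr_ge0 z.1; have p2 := sqr_ge0 z.2.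
    split; rewrite -ler_norml; apply: norm_le_of_sqr; rewrite ?(ltW r0) //;
      apply: le_trans zK; by rewrite ?lerDl ?lerDr.
have KD z : K z -> udisc z by exact: r_disc.
have Ebound z : K z -> `|E z| <= eta.
  move=> Kz.
  have key (s : R) : `|s| = 1 -> forall w, K w -> s * E w <= eta.
    move=> s1; apply: (maximum_principle (g := fun w => s * E w)) => // w Kw.
      by apply: continuousM; [exact: cst_continuous|exact: Ec (KD _ Kw)].
    have [wr|wr] := eqVneq (normsq w) (r ^+ 2).
      left; apply: le_trans (ler_norm _) _; rewrite normrM s1 mul1r; exact: Ecirc.
    right; split; last by have := laplacian_atZ s (EL _ (KD _ Kw)); rewrite mulr0.
    have wlt : normsq w < r ^+ 2 by rewrite lt_neqAle wr.
    have vlt : \forall v \near w, normsq v < r ^+ 2 by exact: (cvgr_lt _ (nc w) _ wlt).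
    by apply: filterS vlt => v /ltW.
  have := key 1 (normr1 _) z Kz; have := key (-1) (normrN1 _) z Kz.
  by rewrite ler_norml; lra.
have cmul0 (a : R * R) : cmul a 0 = 0 by apply: pair_ext; rewrite /= !mulr0 ?subr0 ?addr0.
have avgk (a b : R) : avg N (fun t => k t * (a * cos t + b * sin t)) = 1 / 2 * (c1 * a + c2 * b).
  have -> : avg N (fun t => k t * (a * cos t + b * sin t)) =
     avg N (fun t => c0 * a * cos t + c0 * b * sin t + c1 * a * (cos t * cos t) +
       c2 * b * (sin t * sin t) + (c1 * b + c2 * a) * (cos t * sin t)).
    by apply: avg_eq => t; rewrite /k; ring.
  by rewrite !avgD !avgZ a1 a2 a3 a4 a5; ring.
have H0 : H N 0 = c0 * f 0.
  have -> : H N 0 = avg N (fun t => f 0 * c0 + f 0 * c1 * cos t + f 0 * c2 * sin t).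
    by apply: avg_eq => t; rewrite cmul0 /k; ring.
  by rewrite !avgD !avgZ a1 a2 avg_cst //; ring.
(* The x-derivative suffices: the average sought is the convolution at tau = 0, that is C0 + C1. *)
have dE : is_derive (0 : R) 1 (fun s => E (0 + s, 0)) (1 / 2 * (c1 * fx + c2 * fy) - C1 N / r).
  rewrite (_ : (fun _ => _) = fun s => avg N (fun t => k t * f (s *: cis t)) -
      (C0 N + C1 N / r * s)); last first.
    apply/funext => s; rewrite /E /= mulr0 addr0 add0r; congr (_ - _).
    apply: avg_eq => t; congr (_ * f _).
    by apply: pair_ext; rewrite /= /GRing.scale /=; ring.
  apply: is_deriveB; last by apply: is_derive_eq; rewrite /GRing.scale /=; ring.
  rewrite -avgk; apply: is_derive_avg => t; apply: is_deriveZ.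
  by rewrite mulrC [fy * _]mulrC; exact: fd (normsq_cis t).
have K0 : K 0 by rewrite /K /normsq /= !expr0n /= addr0 sqr_ge0.
have e0 := Ebound 0 K0.
(* The square of half-side r/2 lies inside the disc of radius r. *)
have r20 : 0 < r / 2 by rewrite divr_gt0.
have gE : `|1 / 2 * (c1 * fx + c2 * fy) - C1 N / r| <= 2 * eta / (r / 2).
  apply: (gradient_bound1 (u := E) (z := 0) r20) dE => w; rewrite !subr0 !ler_norml => w1 w2.
  have Kw : K w by rewrite /K /normsq /=; nra.
  by split; [exact: Ec (KD _ Kw)|exact: EL (KD _ Kw)|by have := Ebound _ Kw; rewrite ler_norml].
have -> : avg N (fun t => (c0 + c1 * cos t + c2 * sin t) * f (r *: cis t)) = C0 N + C1 N.
  have := avg_conv N 0; rewrite cos0 sin0 mulr1 mulr0 addr0 => ->.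
  by apply: avg_eq => t; rewrite subr0.
have {}gE : `|r / 2 * (c1 * fx + c2 * fy) - C1 N| <= 4 * eta.
  have -> : r / 2 * (c1 * fx + c2 * fy) - C1 N = r * (1 / 2 * (c1 * fx + c2 * fy) - C1 N / r).
    by field.
  rewrite normrM gtr0_norm // -ler_pdivlMl //; apply: le_trans gE _.
  by rewrite le_eqVlt; apply/orP; left; apply/eqP; field.
have {}e0 : `|c0 * f 0 - C0 N| <= eta.
  by move: e0; rewrite /E H0 /= !mulr0 !addr0.
have -> : eps = 5 * eta by rewrite /eta; field.
by move: gE e0; rewrite !ler_norml; lra.
Qed.

End TrigonometricMoment.

(** * Coordinates of the immersion *)

(** Serves to transport differentiability to the partials of F . v, which are identified with F_x .
    v and F_y . v only on the open disc. *)
Lemma near_eq_differentiable {R : realType} {V W : normedModType R} (f g : V -> W) (x : V) :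
  (\forall y \near x, f y = g y) -> differentiable f x -> differentiable g x.
Proof.
move=> fg fd; have gx : g x = f x by rewrite (nbhs_singleton fg).
have [dc fE] := (diff_locallyP x f).1 fd.
have n0 : \forall h \near (0 : V), f (h + x) = g (h + x).
  have c : h + x @[h --> (0 : V)] --> 0 + x by apply: cvgD; [exact: cvg_id|exact: cvg_cst].
  by rewrite add0r in c; exact: (c _ fg).
have gE : g \o shift x = cst (g x) + 'd f x +o_ 0 id.
  apply/eqaddoP => e e0.
  have /eqaddoP/(_ e e0) fo := fE.
  apply: filterS2 n0 fo => h E; rewrite gx.
  by rewrite !fctE /= E.
have dE := diff_unique dc gE.
by apply/diff_locallyP; rewrite dE.
Qed.

Section DotProduct.
Variables (R : realType) (n : nat).
Implicit Types (u v w : 'rV[R]_n) (a b : R).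

Lemma dotpC u v : dotp u v = dotp v u.
Proof. by apply: eq_bigr => i _; rewrite mulrC. Qed.

Lemma dotpDl u v w : dotp (u + v) w = dotp u w + dotp v w.
Proof. by rewrite /dotp -big_split; apply: eq_bigr => i _; rewrite mxE mulrDl. Qed.

Lemma dotpZl a u v : dotp (a *: u) v = a * dotp u v.
Proof. by rewrite /dotp mulr_sumr; apply: eq_bigr => i _; rewrite mxE mulrA. Qed.

Lemma dotpDr u v w : dotp w (u + v) = dotp w u + dotp w v.
Proof. by rewrite dotpC dotpDl !(dotpC w). Qed.

Lemma dotpZr a u v : dotp u (a *: v) = a * dotp u v.
Proof. by rewrite dotpC dotpZl (dotpC u). Qed.

Lemma dotp_ge0 u : 0 <= dotp u u.
Proof. by apply: sumr_ge0 => i _; rewrite -expr2 sqr_ge0. Qed.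

Lemma enorm_sqr u : enorm u ^+ 2 = dotp u u.
Proof. by rewrite /enorm sqr_sqrtr // dotp_ge0. Qed.

Lemma enorm_ge0 u : 0 <= enorm u.
Proof. exact: sqrtr_ge0. Qed.

Lemma dotp_eq0 u : dotp u u = 0 -> u = 0.
Proof.
move=> H; apply/rowP => i; rewrite mxE; apply/eqP; rewrite -sqrf_eq0.
have /psumr_eq0P : forall j, true -> 0 <= u 0 j * u 0 j by move=> j _; rewrite -expr2 sqr_ge0.
by move=> /(_ H i isT); rewrite -expr2 => ->.
Qed.

(** Expand the square of L w - (w . u) u - (w . v) v. With L = 1 it bounds two components of F; with
    L = |F_x|^2 it says |grad (F . q)| <= |dF|. *)
Lemma bessel2 u v w (L : R) : 0 < L -> dotp u u = L -> dotp v v = L -> dotp u v = 0 ->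
  dotp w u ^+ 2 + dotp w v ^+ 2 <= L * dotp w w.
Proof.
move=> L0 uu vv uv.
have := dotp_ge0 (L *: w + ((- dotp w u) *: u + (- dotp w v) *: v)).
rewrite !(dotpDl, dotpDr, dotpZl, dotpZr) uu vv uv (dotpC v u) uv (dotpC u w) (dotpC v w).
set p := dotp w u; set q := dotp w v; set x := dotp w w => H.
have : 0 <= L * (L * x - (p ^+ 2 + q ^+ 2)) by lra.
by rewrite pmulr_rge0 // subr_ge0.
Qed.

Lemma is_derive_dotp (G : R * R -> 'rV[R]_n) (z e : R * R) v : differentiable G z ->
  differentiable (fun z => dotp (G z) v) z /\
  'D_e (fun z => dotp (G z) v) z = dotp ('D_e G z) v.
Proof.
move=> Gd.
have cd i : differentiable (fun z => G z 0 i) z.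
  by apply: (@differentiable_comp _ _ _ _ G (fun M : 'rV[R]_n => M 0 i : R)) => //;
    exact: differentiable_coord.
have E : (fun z => dotp (G z) v) = \sum_(i < n) (fun z => v 0 i *: G z 0 i).
  apply/funext => y; rewrite fct_sumE; apply: eq_bigr => i _.
  by rewrite /GRing.scale /= mulrC.
have cd' i : differentiable (fun z => v 0 i *: G z 0 i) z by exact: differentiableZ.
split; first by rewrite E; exact: differentiable_sum.
rewrite E derive_sum; last by move=> i; exact: diff_derivable.
rewrite derive_mx; last exact: diff_derivable.
rewrite /dotp; apply: eq_bigr => i _; rewrite mxE deriveZ; last exact: diff_derivable.
by rewrite /GRing.scale /= mulrC.
Qed.

Lemma harmonic_dotp (F : R * R -> 'rV[R]_n) v : conformal_minimal_immersion F ->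
  harmonic_on (@udisc R) (fun z => dotp (F z) v) /\
  forall z, udisc z -> 'D_(e_x R) (fun z => dotp (F z) v) z = dotp (partial_x F z) v /\
    'D_(e_y R) (fun z => dotp (F z) v) z = dotp (partial_y F z) v.
Proof.
move=> [C2 lap _ _].
have dx z : udisc z -> 'D_(e_x R) (fun z => dotp (F z) v) z = dotp (partial_x F z) v.
  by move=> /C2[Fd _ _ _ _]; have [_] := is_derive_dotp (e_x R) v Fd.
have dy z : udisc z -> 'D_(e_y R) (fun z => dotp (F z) v) z = dotp (partial_y F z) v.
  by move=> /C2[Fd _ _ _ _]; have [_] := is_derive_dotp (e_y R) v Fd.
split; last by move=> z zD; split; [exact: dx|exact: dy].
move=> z zD; have [Fd Fxd Fyd _ _] := C2 z zD.
have [hd _] := is_derive_dotp 0 v Fd.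
have [xd xE] := is_derive_dotp (e_x R) v Fxd.
have [yd yE] := is_derive_dotp (e_y R) v Fyd.
have nx : \forall y \near z, dotp (partial_x F y) v = 'D_(e_x R) (fun z => dotp (F z) v) y.
  by apply: filterS (open_udisc zD) => y /dx.
have ny : \forall y \near z, dotp (partial_y F y) v = 'D_(e_y R) (fun z => dotp (F z) v) y.
  by apply: filterS (open_udisc zD) => y /dy.
split => //.
- exact: near_eq_differentiable nx xd.
- exact: near_eq_differentiable ny yd.
rewrite -(near_eq_derive _ nx) -(near_eq_derive _ ny) xE yE -dotpDl.
have -> : 'D_(e_x R) (partial_x F) z + 'D_(e_y R) (partial_y F) z = 0 by exact: lap.
by rewrite /dotp big1 // => i _; rewrite mxE mul0r.
Qed.

End DotProduct.

(** * Schwarz-Pick inequality in the radial direction *)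

Lemma continuous_mobius {R : realType} (w e z : R * R) :
  udisc w -> normsq e = 1 -> udisc z ->
  {for z, continuous (fun z => mobius w (cmul e z))}.
Proof.
move=> wD e1 zD.
have ezD := udisc_cmul e1 zD.
have Q0 := mobius_den wD ezD; rewrite /normsq in Q0.
have z1 : {for z, continuous (fun w : R * R => w.1)} by exact: cvg_fst.
have z2 : {for z, continuous (fun w : R * R => w.2)} by exact: cvg_snd.
have cc (a : R) : {for z, continuous (fun _ : R * R => a)} by exact: cst_continuous.
have m1 : {for z, continuous (fun z : R * R => (cmul e z).1)}.
  exact: (continuousB (continuousM (cc _) z1) (continuousM (cc _) z2)).
have m2 : {for z, continuous (fun z : R * R => (cmul e z).2)}.
  exact: (continuousD (continuousM (cc _) z2) (continuousM (cc _) z1)).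
have p1 : {for z, continuous (fun z : R * R => (cmul e z + w).1)}.
  exact: (continuousD m1 (cc _)).
have p2 : {for z, continuous (fun z : R * R => (cmul e z + w).2)}.
  exact: (continuousD m2 (cc _)).
have q1 : {for z, continuous (fun z : R * R => ((1, 0) + cmul (conjz w) (cmul e z)).1)}.
  exact: (continuousD (cc _) (continuousB (continuousM (cc _) m1) (continuousM (cc _) m2))).
have q2 : {for z, continuous (fun z : R * R => ((1, 0) + cmul (conjz w) (cmul e z)).2)}.
  exact: (continuousD (cc _) (continuousD (continuousM (cc _) m2) (continuousM (cc _) m1))).
have d : {for z, continuous (fun z : R * R => (((1, 0) + cmul (conjz w) (cmul e z)).1 ^+ 2 +
    ((1, 0) + cmul (conjz w) (cmul e z)).2 ^+ 2)^-1)}.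
  apply: continuousV; first exact: Q0.
  exact: (continuousD (continuousM q1 q1) (continuousM q2 q2)).
exact: (cvg_pair (continuousM (continuousD (continuousM p1 q1) (continuousM p2 q2)) d)
  (continuousM (continuousB (continuousM p2 q1) (continuousM p1 q2)) d)).
Qed.

(** * Sharp inequality for two components of the map *)

Section WeightedInequality.
Variables (R : realType) (h : R * R -> R) (w c : R * R).
Hypothesis hh : harmonic_on (@udisc R) h.
Hypotheses (wD : udisc w) (c1 : normsq c = 1).

(** Precomposing with the rotation by c turns the coordinate directions at 0 into c and i c at w, so
    the two first-order coefficients are derivatives of h along these. *)
Lemma mobius_moment (r c0 k1 k2 eps : R) : 0 < r -> r < 1 -> 0 < eps ->
  exists M0, forall M, (M0 <= M)%N ->
  `|avg (4 * M.+1) (fun t => (c0 + k1 * cos t + k2 * sin t) *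
       h (mobius w (cmul c (r *: cis t)))) -
    (c0 * h w + r / 2 * (1 - normsq w) *
      (k1 * (c.1 * 'D_(e_x R) h w + c.2 * 'D_(e_y R) h w) +
       k2 * (c.1 * 'D_(e_y R) h w - c.2 * 'D_(e_x R) h w)))| <= eps.
Proof.
move=> r0 r1 eps0.
have cmulA (a b d : R * R) : cmul a (cmul b d) = cmul (cmul a b) d.
  by apply: pair_ext => /=; ring.
have M0w : mobius w (cmul c 0) = w.
  have -> : cmul c 0 = 0 by apply: pair_ext; rewrite /= !mulr0 ?subr0 ?addr0.
  rewrite /mobius add0r; have -> : cmul (conjz w) 0 = 0.
    by apply: pair_ext; rewrite /= !mulr0 ?subr0 ?addr0.
  by apply: pair_ext; rewrite /= !addr0 expr1n expr0n /= addr0 divr1 mulr1 mulr0 ?addr0 ?subr0.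
set hx := 'D_(e_x R) h w; set hy := 'D_(e_y R) h w.
have [|||M0 HM] := @trig_moment R (fun z => h (mobius w (cmul c z)))
  ((1 - normsq w) * (c.1 * hx + c.2 * hy)) ((1 - normsq w) * (c.1 * hy - c.2 * hx))
  r c0 k1 k2 r0 r1 _ _ _ eps eps0.
- move=> z zD; apply: (@continuous_comp _ _ _ (fun z => mobius w (cmul c z)) h).
    exact: continuous_mobius.
  have [hd _ _ _] := hh (mobius_udisc wD (udisc_cmul c1 zD)).
  exact: differentiable_continuous.
- move=> e z e1 zD; rewrite (_ : (fun _ => _) = fun z => h (mobius w (cmul (cmul c e) z))).
    by apply: laplacian_at_mobius => //; rewrite normsq_cmul c1 e1 mulr1.
  by apply/funext => y; rewrite cmulA.
- move=> e e1; have := is_derive_mobius hh wD c1 e; rewrite -/hx -/hy.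
  by move=> H; apply: (is_derive_eq H); rewrite /=; ring.
exists M0 => M /HM; rewrite M0w.
rewrite (_ : r / 2 * (k1 * _ + k2 * _) = r / 2 * (1 - normsq w) *
  (k1 * (c.1 * hx + c.2 * hy) + k2 * (c.1 * hy - c.2 * hx))) //.
by ring.
Qed.

End WeightedInequality.

(* [1 + s^2 + 2 s cos t = |1 + s e^it|^2] times the boundary value
   [(e^it + s) / (1 + s e^it)] of a conformal automorphism of the disc is a
   trigonometric polynomial of degree one, so only the value and the first
   derivatives of the harmonic map at the centre are needed. *)
Lemma weight_pointwise {R : realType} (s t x y : R) : x ^+ 2 + y ^+ 2 <= 1 ->
  (2 * s + (1 + s ^+ 2) * cos t) * x + (1 - s ^+ 2) * sin t * y <=
  1 + s ^+ 2 + 2 * s * cos t.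
Proof.
move=> xy; have cs := cos2Dsin2 t; set C := cos t in cs *; set S := sin t in cs *.
set W := 1 + s ^+ 2 + 2 * s * C.
have S2 : S ^+ 2 = 1 - C ^+ 2 by lra.
have W0 : 0 <= W.
  have -> : W = (s + C) ^+ 2 + S ^+ 2 by rewrite S2 /W; ring.
  by rewrite addr_ge0 ?sqr_ge0.
(* A + i B is (e^it + s)(1 + s e^-it), of modulus W = |1 + s e^it|^2. *)
pose A := 2 * s + (1 + s ^+ 2) * C; pose B := (1 - s ^+ 2) * S.
have WE : W ^+ 2 = A ^+ 2 + B ^+ 2.
  by rewrite /A /B exprMn S2 /W; ring.
rewrite -/A -/B; apply: le_trans (ler_norm _) _; apply: norm_le_of_sqr => //.
have : (A * x + B * y) ^+ 2 + (A * y - B * x) ^+ 2 = (A ^+ 2 + B ^+ 2) * (x ^+ 2 + y ^+ 2) by ring.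
have := sqr_ge0 (A * y - B * x).
have : (A ^+ 2 + B ^+ 2) * (x ^+ 2 + y ^+ 2) <= A ^+ 2 + B ^+ 2.
  by rewrite -[leRHS]mulr1 ler_wpM2l // addr_ge0 ?sqr_ge0.
by rewrite WE; lra.
Qed.

(** The pointwise inequality is averaged over |z| = r, where cos has mean 0 on the right, and then r
    tends to 1. *)
Lemma weighted_inequality {R : realType} (h1 h2 : R * R -> R) (w c : R * R) (s : R) :
  harmonic_on (@udisc R) h1 -> harmonic_on (@udisc R) h2 ->
  (forall z, udisc z -> h1 z ^+ 2 + h2 z ^+ 2 <= 1) -> udisc w -> normsq c = 1 ->
  2 * s * h1 w + 1 / 2 * (1 - normsq w) *
    ((1 + s ^+ 2) * (c.1 * 'D_(e_x R) h1 w + c.2 * 'D_(e_y R) h1 w) +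
     (1 - s ^+ 2) * (c.1 * 'D_(e_y R) h2 w - c.2 * 'D_(e_x R) h2 w)) <= 1 + s ^+ 2.
Proof.
move=> hh1 hh2 h12 wD c1.
set X := (1 + s ^+ 2) * _ + _.
have step (r : R) : 0 < r -> r < 1 ->
    2 * s * h1 w + r / 2 * (1 - normsq w) * X <= 1 + s ^+ 2.
  move=> r0 r1; apply/ler_addgt0Pr => e e0; have e20 : 0 < e / 2 by rewrite divr_gt0.
  have [M1 H1] := mobius_moment hh1 wD c1 (2 * s) (1 + s ^+ 2) 0 r0 r1 e20.
  have [M2 H2] := mobius_moment hh2 wD c1 0 0 (1 - s ^+ 2) r0 r1 e20.
  have := H1 (maxn M1 M2) (leq_maxl _ _); have := H2 (maxn M1 M2) (leq_maxr _ _).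
  set M := maxn _ _.
  set A2 := avg _ _; set A1 := avg _ _ => B2 B1.
  have A12 : A1 + A2 <= 1 + s ^+ 2.
    have [a1 _ _ _ _] := @avg_cos_sin R M.
    have -> : 1 + s ^+ 2 = avg (4 * M.+1) (fun t : R => 1 + s ^+ 2 + 2 * s * cos t).
      by rewrite avgD avgZ a1 avg_cst // mulr0 addr0.
    rewrite /A1 /A2 -avgD; apply: avg_le => // t.
    have zD : udisc (mobius w (cmul c (r *: cis t))).
      apply: mobius_udisc => //; rewrite /udisc /=.
      have := normsq_cmul c (r *: cis t); rewrite c1 mul1r /normsq /= => ->.
      by rewrite /GRing.scale /= !exprMn -mulrDr cos2Dsin2 mulr1 expr_lt1 // ltW.
    have := weight_pointwise s t (h12 _ zD).
    set x := h1 _; set y := h2 _; lra.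
  move: B1 B2; rewrite !ler_norml => /andP[B1 _] /andP[B2 _].
  move: B1 B2; rewrite /X.
  set T1 := c.1 * _ + _; set N1 := c.1 * _ - _; set T2 := c.1 * _ + c.2 * _; set N2 := c.1 * 'D_(e_y R) h2 w - _.
  rewrite !mul0r !add0r addr0; lra.
apply/ler_addgt0Pr => e e0.
pose Y := 1 / 2 * (1 - normsq w) * X.
(* The first entry keeps r positive, the second makes (1 - r) Y at most e. *)
pose r := Num.max (1 / 2) (1 - e / (1 + `|Y|)).
have Y1 : 0 < 1 + `|Y| by have := normr_ge0 Y; lra.
have q0 : 0 < e / (1 + `|Y|) by rewrite divr_gt0.
have r0 : 0 < r by rewrite lt_max; apply/orP; left; lra.
have r1 : r < 1 by rewrite gt_max; apply/andP; split; lra.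
have r2 : 1 - e / (1 + `|Y|) <= r by rewrite le_max lexx orbT.
have := step r r0 r1.
have -> : r / 2 * (1 - normsq w) * X = Y - (1 - r) * Y by rewrite /Y; field.
rewrite -/Y.
have : (1 - r) * Y <= e.
  have F1 : (1 - r) * Y <= (1 - r) * `|Y| by rewrite ler_wpM2l ?ler_norm // subr_ge0 ltW.
  have F2 : (1 - r) * `|Y| <= e / (1 + `|Y|) * (1 + `|Y|).
    apply: ler_pM; rewrite ?subr_ge0 ?(ltW r1) ?normr_ge0 //; lra.
  by move: F2; rewrite divfK ?gt_eqF //; lra.
by lra.
Qed.

Lemma dotp_unit_le {R : realType} n (q x : 'rV[R]_n) : dotp q q = 1 -> `|dotp x q| <= enorm x.
Proof.
move=> q1; apply: norm_le_of_sqr; first exact: enorm_ge0.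
have := dotp_ge0 (x + (- dotp x q) *: q).
rewrite enorm_sqr !(dotpDl, dotpDr, dotpZl, dotpZr) q1 (dotpC q x); lra.
Qed.

Lemma unit_direction {R : realType} n (v : 'rV[R]_n) : 0 < enorm v ->
  exists2 q, v = enorm v *: q & dotp q q = 1.
Proof.
move=> v0; have := enorm_sqr v; move: (enorm v) v0 => s s0 ss.
have sn : s != 0 by rewrite gt_eqF.
exists (s^-1 *: v); first by rewrite scalerA (mulfV sn) scale1r.
by rewrite dotpZl dotpZr -ss expr2 (mulKf sn) mulVf.
Qed.

(** Here c is the direction of the gradient of F . q, and v the normalised image of i c. As F . q is
    stationary along i c, v is orthogonal to q; conformality gives the image of i c the length la,
    and Bessel gives mu <= la. *)
Lemma conformal_frame {R : realType} n (X Y q : 'rV[R]_n) (L : R) :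
  0 < L -> dotp X X = L -> dotp Y Y = L -> dotp X Y = 0 -> dotp q q = 1 ->
  0 < dotp X q ^+ 2 + dotp Y q ^+ 2 ->
  exists (v : 'rV[R]_n) (c : R * R) (mu la : R),
    [/\ dotp v v = 1 /\ dotp q v = 0, normsq c = 1,
        [/\ 0 < mu, mu <= la & mu ^+ 2 = dotp X q ^+ 2 + dotp Y q ^+ 2],
        c.1 * dotp X q + c.2 * dotp Y q = mu &
        c.1 * dotp Y v - c.2 * dotp X v = la].
Proof.
move=> L0 xL yL xy qq; set al := dotp X q; set be := dotp Y q.
set m2 := al ^+ 2 + be ^+ 2 => m2p.
pose mu := Num.sqrt m2; have mu2 : mu ^+ 2 = m2 by rewrite sqr_sqrtr // ltW.
have mup : 0 < mu by rewrite sqrtr_gt0.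
pose la := Num.sqrt L; have la2 : la ^+ 2 = L by rewrite sqr_sqrtr // ltW.
have lap : 0 < la by rewrite sqrtr_gt0.
have mun : mu != 0 by rewrite gt_eqF.
have lan : la != 0 by rewrite gt_eqF.
have mula : mu <= la.
  rewrite /mu /la ler_wsqrtr //.
  by have := bessel2 q L0 xL yL xy; rewrite qq mulr1 (dotpC q) (dotpC q).
pose k := (mu * la)^-1.
pose v := k *: ((- be) *: X + al *: Y).
have vX : dotp X v = - (k * be * la ^+ 2).
  by rewrite /v dotpZr dotpDr !dotpZr xL xy la2; ring.
have vY : dotp Y v = k * al * la ^+ 2.
  by rewrite /v dotpZr dotpDr !dotpZr yL (dotpC Y) xy la2; ring.
have vq : dotp q v = 0.
  by rewrite /v dotpZr dotpDr !dotpZr (dotpC q) (dotpC q) -/al -/be; ring.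
have vv : dotp v v = k ^+ 2 * la ^+ 2 * m2.
  by rewrite {1}/v dotpZl dotpDl !dotpZl vX vY /m2; ring.
rewrite /k in vX vY vv; clearbody v la mu.
exists v, (al / mu, be / mu), mu, la; split => //=.
- by split => //; rewrite vv -mu2; field; rewrite ?mun ?lan.
- apply: (@eq_trans _ _ (m2 / mu ^+ 2)); first by rewrite /normsq /= /m2; field.
  by rewrite mu2 divff // gt_eqF.
- apply: (@eq_trans _ _ (m2 / mu)); first by rewrite /m2; field.
  by rewrite -mu2; field.
- rewrite vX vY; apply: (@eq_trans _ _ (m2 * la / mu ^+ 2)); first by rewrite /m2; field; rewrite ?mun ?lan.
  by rewrite -mu2; field.
Qed.

(* The inequality is tested against the normal [q] and the unit image [v] of
   the domain direction in which [F . q] is stationary; since [mu <= la], the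
   second weight may be replaced by the first. *)
Lemma radial_gradient {R : realType} n (F : R * R -> 'rV[R]_n) (w c : R * R) (q : 'rV[R]_n) :
  conformal_minimal_immersion F -> (forall z, udisc z -> enorm (F z) < 1) ->
  udisc w -> normsq c = 1 -> F w = enorm (F w) *: q -> dotp q q = 1 ->
  (1 - normsq w) * (c.1 * dotp (partial_x F w) q + c.2 * dotp (partial_y F w) q)
    <= 1 - enorm (F w) ^+ 2.
Proof.
move=> FF F1 wD c1 + qq; have := F1 w wD; have := enorm_ge0 (F w).
have [s sE] : exists s, s = enorm (F w) by eexists.
have [X XE] : exists X, X = partial_x F w by eexists.
have [Y YE] : exists Y, Y = partial_y F w by eexists.
have [k kE] : exists k, k = 1 - normsq w by eexists.
rewrite -sE -XE -YE -kE => s0 s1 Fq.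
have k0 : 0 < k by rewrite kE subr_gt0.
have s2 : 0 < 1 - s ^+ 2 by rewrite subr_gt0 expr_lt1.
have [_ _ conf imm] := FF; have := conf w wD; rewrite -XE -YE => -[xy xy0].
have xL : 0 < dotp X X.
  rewrite lt_neqAle dotp_ge0 andbT eq_sym; apply/eqP => /dotp_eq0 H.
  by have := imm w wD; rewrite -XE H eqxx.
have yL : dotp Y Y = dotp X X by rewrite -(enorm_sqr Y) -xy enorm_sqr.
have [h1 d1] := harmonic_dotp q FF; have := d1 w wD; rewrite -XE -YE => -[dx1 dy1].
have Fwq : dotp (F w) q = s by rewrite Fq dotpZl qq mulr1.
have [m0|m0] := eqVneq (dotp X q ^+ 2 + dotp Y q ^+ 2) 0.
  move: m0 => /eqP; rewrite paddr_eq0 ?sqr_ge0 // !sqrf_eq0 => /andP[/eqP -> /eqP ->].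
  by rewrite !mulr0 addr0 mulr0 ltW.
have m2p : 0 < dotp X q ^+ 2 + dotp Y q ^+ 2.
  by rewrite lt_neqAle eq_sym m0 addr_ge0 ?sqr_ge0.
have [v [c' [mu [la [[vv qv] c'1 [mup mula mu2] cmu cla]]]]] :=
  conformal_frame xL (erefl _) yL xy0 qq m2p.
have [h2 d2] := harmonic_dotp v FF; have := d2 w wD; rewrite -XE -YE => -[dx2 dy2].
have h12 z : udisc z -> dotp (F z) q ^+ 2 + dotp (F z) v ^+ 2 <= 1.
  move=> zD; apply: le_trans (bessel2 (F z) ltr01 qq vv qv) _.
  rewrite mul1r -enorm_sqr; move: (F1 z zD) (enorm_ge0 (F z)).
  by move: (enorm _) => a a1 a0; rewrite exprn_ile1 // ltW.
have := weighted_inequality s h1 h2 h12 wD c'1.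
rewrite dx1 dy1 dx2 dy2 Fwq cmu cla -kE.
move: mu2; move: (dotp X q) (dotp Y q) => al be mu2 W.
have cm : c.1 * al + c.2 * be <= mu.
  apply: le_trans (ler_norm _) _; apply: norm_le_of_sqr; first exact: ltW.
  rewrite mu2; have := sqr_ge0 (c.1 * be - c.2 * al).
  have : (c.1 * al + c.2 * be) ^+ 2 + (c.1 * be - c.2 * al) ^+ 2 = normsq c * (al ^+ 2 + be ^+ 2).
    by rewrite /normsq; ring.
  rewrite c1; lra.
apply: (@le_trans _ _ (k * mu)); first by rewrite ler_pM2l.
(* With la lowered to mu the weights add up to 2, and moving 2 s^2 to the right turns 1 + s^2 into 1
   - s^2. *)
have : k * ((1 - s ^+ 2) * mu) <= k * ((1 - s ^+ 2) * la).
  by rewrite ler_pM2l // ler_pM2l.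
by move: W; lra.
Qed.

(** One-sided because a maximum over a segment may sit at its right end. *)
Lemma is_derive_left_max {R : realType} (f : R -> R) (x a c : R) : a < x ->
  is_derive x 1 f c -> (forall y, a <= y -> y <= x -> f y <= f x) -> 0 <= c.
Proof.
move=> ax fc fmax; rewrite leNgt; apply/negP => c0.
have e0 : 0 < - c / 2 by lra.
have [d d0 H] := is_derive_eps fc e0.
pose m := Num.min (x - a) d / 2.
have M0 : 0 < Num.min (x - a) d by rewrite lt_min d0 subr_gt0 ax.
have [M1 M2] : Num.min (x - a) d <= x - a /\ Num.min (x - a) d <= d by rewrite !ge_min !lexx orbT.
have m0 : 0 < m by rewrite /m; lra.
have := H (- m); rewrite normrN gtr0_norm // => /(_ ltac:(rewrite /m; lra)).
have := fmax (x - m) ltac:(rewrite /m; lra) ltac:(lra).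
rewrite ler_norml; nra.
Qed.

Lemma hyperbolic_sub_mono {R : realType} (m s y : R) : m <= s -> y ^+ 2 <= 1 ->
  0 < 1 - m * y -> 0 < 1 - s * y -> (m - y) / (1 - m * y) <= (s - y) / (1 - s * y).
Proof.
move=> ms y1 my sy; rewrite ler_pdivrMr // mulrAC ler_pdivlMr // -subr_ge0.
have -> : (s - y) * (1 - m * y) - (m - y) * (1 - s * y) = (s - m) * (1 - y ^+ 2) by ring.
by rewrite mulr_ge0 // subr_ge0.
Qed.

(** * Growth of the norm along a radius *)

Section RadialGrowth.
Variables (R : realType) (n : nat) (F : R * R -> 'rV[R]_n) (z0 : R * R).
Hypothesis FF : conformal_minimal_immersion F.
Hypothesis F1 : forall z, udisc z -> enorm (F z) < 1.
Hypothesis z01 : normsq z0 = 1.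

Let ray (x : R) : R * R := (x * z0.1, x * z0.2).

Let normsq_ray x : normsq (ray x) = x ^+ 2.
Proof. by rewrite /normsq /= !exprMn -mulrDr; have := z01; rewrite /normsq => ->; rewrite mulr1. Qed.

Let rayD x : 0 <= x -> x < 1 -> udisc (ray x).
Proof. by move=> x0 x1; rewrite /udisc /= -/(normsq (ray x)) normsq_ray expr_lt1. Qed.

Let sg x := enorm (F (ray x)).

Let dotp_ray x v : udisc (ray x) ->
  is_derive x 1 (fun y => dotp (F (ray y)) v)
   (z0.1 * dotp (partial_x F (ray x)) v + z0.2 * dotp (partial_y F (ray x)) v).
Proof.
move=> xD; have [h d] := harmonic_dotp v FF; have [dx dy] := d _ xD.
have [hd _ _ _] := h _ xD.
have l (a : R) : is_derive x 1 (fun y => y * a) a.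
  by apply: is_derive_eq; rewrite /GRing.scale /=; ring.
have H := @is_derive_curve R (fun z => dotp (F z) v) (fun y => y * z0.1) (fun y => y * z0.2)
  x z0.1 z0.2 hd (l _) (l _).
by apply: (is_derive_eq H); congr (_ * _ + _ * _); [exact: dx|exact: dy].
Qed.

Let sg_continuous x : udisc (ray x) -> {for x, continuous sg}.
Proof.
move=> xD.
have c i : {for x, continuous (fun y => F (ray y) 0 i)}.
  have := dotp_ray (delta_mx 0 i) xD => -[/derivable1_diffP/differentiable_continuous].
  rewrite (_ : (fun y => dotp _ _) = fun y => F (ray y) 0 i) //.
  apply/funext => y; rewrite /dotp (bigD1 i) //= mxE !eqxx mulr1 big1 ?addr0 // => j ji.
  by rewrite mxE (negbTE ji) andbF mulr0.
apply: (@continuous_comp _ _ _ (fun y => dotp (F (ray y)) (F (ray y))) Num.sqrt); last exact: sqrt_continuous.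
by apply: cvg_big => [|i _]; [exact: add_continuous|apply: cvgM; exact: c].
Qed.

(* The left side is tanh (artanh (sg x) - artanh x). At a maximum [c > 0] of it,
   perturbed by [- e * x], [sg] may be replaced by the smooth minorant
   [dotp (F (ray x)) q] touching it at [c]; this avoids the zeros of [sg]. *)
Lemma hyperbolic_growth x : 0 <= x -> x < 1 ->
  (sg x - x) / (1 - sg x * x) <= sg 0.
Proof.
move=> x0 x1.
have sge y : 0 <= sg y by exact: enorm_ge0.
have den y : 0 <= y -> y <= x -> 0 < 1 - sg y * y.
  move=> y0 yx; have y1 : y < 1 by lra.
  have s1 := F1 (rayD y0 y1); rewrite -/(sg y) in s1.
  have s0 := sge y.
  have : sg y * y <= sg y by rewrite -[leRHS]mulr1 ler_wpM2l // ltW.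
  by lra.
apply/ler_addgt0Pr => e e0.
have [c] : exists2 c, c \in `[0, x] & forall t, t \in `[0, x] ->
    (sg t - t) / (1 - sg t * t) - e * t <= (sg c - c) / (1 - sg c * c) - e * c.
  apply: (@EVT_max _ (fun t => (sg t - t) / (1 - sg t * t) - e * t)) => //.
  apply: continuous_in_subspaceT => t; rewrite inE /= in_itv /= => /andP[t0 tx].
  have tc := sg_continuous (rayD t0 (le_lt_trans tx x1)).
  have ic : {for t, continuous (fun t : R => t)} by exact: cvg_id.
  have cc (a : R) : {for t, continuous (fun _ : R => a)} by exact: cst_continuous.
  have dc : {for t, continuous (fun t => (1 - sg t * t)^-1)}.
    apply: continuousV; first by rewrite gt_eqF // den.
    exact: (continuousB (cc _) (continuousM tc ic)).
  exact: (continuousB (continuousM (continuousB tc ic) dc) (continuousM (cc _) ic)).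
rewrite in_itv /= => /andP[c0 cx] cmax.
have xin : x \in `[0, x] by rewrite in_itv /= x0 lexx.
have := cmax x xin.
suff : (sg c - c) / (1 - sg c * c) - e * c <= sg 0.
  have : e * x <= e by rewrite -[leRHS]mulr1 ler_wpM2l ?ltW.
  lra.
have ec : 0 <= e * c by rewrite mulr_ge0 // ltW.
have [c00|cn0] := eqVneq c 0.
  by rewrite c00 !mulr0 !subr0 divr1.
have cp : 0 < c by rewrite lt_neqAle eq_sym cn0.
have [s0|sn0] := eqVneq (sg c) 0.
  by rewrite s0 mul0r subr0 divr1; have := sge 0; lra.
have sp : 0 < sg c by rewrite lt_neqAle eq_sym sn0 sge.
(* At a positive c with F nonzero there, the perturbation forces a strictly negative derivative,
   which contradicts maximality from the left. *)
exfalso.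
have cD : udisc (ray c) by apply: rayD => //; lra.
have [q Fq qq] := unit_direction sp.
have [m mE] : exists m : R -> R, m = fun y => dotp (F (ray y)) q by eexists.
have mc : m c = sg c by rewrite mE {1}Fq dotpZl qq mulr1.
have := dotp_ray q cD; rewrite -mE.
have mle' : (z0.1 * dotp (partial_x F (ray c)) q + z0.2 * dotp (partial_y F (ray c)) q) *
    (1 - c ^+ 2) <= 1 - sg c ^+ 2.
  by have := radial_gradient FF F1 cD z01 Fq qq; rewrite normsq_ray mulrC.
have msg y : m y <= sg y.
  by rewrite mE; exact: le_trans (ler_norm _) (dotp_unit_le _ qq).
move: mle'; move: (z0.1 * _ + z0.2 * _) => m' mle md; clear mE.
have dn : 1 - m c * c != 0 by rewrite mc gt_eqF // den.
(* The numerator of the quotient's derivative is the difference of the two sides of the radial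
   gradient bound. *)
have fd : is_derive c 1 (fun y => (m y - y) / (1 - m y * y) - e * y)
   ((m' * (1 - c ^+ 2) - (1 - m c ^+ 2)) / (1 - m c * c) ^+ 2 - e).
  have vd : is_derive c 1 (fun y => (1 - m y * y)^-1)
      (- (1 - m c * c) ^- 2 *: (- (m c + c * m'))).
    by apply: is_deriveV => //; apply: is_derive_eq; rewrite /GRing.scale /=; ring.
  by apply: is_derive_eq; rewrite /GRing.scale /=; field.
have : (m' * (1 - c ^+ 2) - (1 - m c ^+ 2)) / (1 - m c * c) ^+ 2 <= 0.
  by rewrite mulr_le0_ge0 ?invr_ge0 ?sqr_ge0 // subr_le0 mc.
suff : 0 <= (m' * (1 - c ^+ 2) - (1 - m c ^+ 2)) / (1 - m c * c) ^+ 2 - e by lra.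
apply: (is_derive_left_max cp fd) => y y0 yc; rewrite mc.
have yx : y <= x by lra.
have yin : y \in `[0, x] by rewrite in_itv /= y0 yx.
apply: le_trans (cmax y yin); rewrite lerD2r.
have my : m y * y <= sg y * y by rewrite ler_wpM2r.
have dy := den y y0 yx.
apply: hyperbolic_sub_mono => //; last by lra.
by rewrite exprn_ile1 //; lra.
Qed.

End RadialGrowth.

(** * Boundary differential *)

Lemma harmonic_laplacian {R : realType} (h : R * R -> R) (z : R * R) :
  harmonic_on (@udisc R) h -> udisc z -> laplacian_at h z 0.
Proof.
move=> hh zD; have nz := open_udisc zD; have [_ _ _ L] := hh z zD.
have d1 (a s : R) : is_derive s 1 (fun t => a + t) 1.
  by apply: is_derive_eq; rewrite /GRing.scale /=; ring.
have d0 (a s : R) : is_derive s 1 (fun _ : R => a) 0 by exact: is_derive_cst.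
have n1 (a : R) : \forall s \near (0 : R), is_derive (s : R) 1 (fun t => a + t) 1.
  by apply: (near_at0 ltr01) => s _.
have n0 (a : R) : \forall s \near (0 : R), is_derive (s : R) 1 (fun _ : R => a) 0.
  by apply: (near_at0 ltr01) => s _.
have Hx := has_derive2_curve (X := fun s => z.1 + s) (Y := fun=> z.2)
  (X1 := fun=> 1) (Y1 := fun=> 0) hh (near_line1 nz) (n1 _) (n0 _) (d0 _ _) (d0 _ _).
have Hy := has_derive2_curve (X := fun=> z.1) (Y := fun s => z.2 + s)
  (X1 := fun=> 0) (Y1 := fun=> 1) hh (near_line2 nz) (n0 _) (n1 _) (d0 _ _) (d0 _ _).
have alg (hx hy hxx hyy hs : R) :
    0 * hx + 0 * hy + (1 ^+ 2 * hxx + 0 ^+ 2 * hyy + 1 * 0 * hs) +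
    (0 * hx + 0 * hy + (0 ^+ 2 * hxx + 1 ^+ 2 * hyy + 0 * 1 * hs)) = hxx + hyy by ring.
eexists; eexists; split; [exact: Hx|exact: Hy|].
rewrite /= !addr0 -surjective_pairing.
exact: etrans (alg _ _ _ _ _) L.
Qed.

Lemma dotp_delta {R : realType} n (v : 'rV[R]_n) i : dotp v (delta_mx 0 i) = v 0 i.
Proof.
rewrite /dotp (bigD1 i) //= mxE !eqxx mulr1 big1 ?addr0 // => j ji.
by rewrite mxE (negbTE ji) andbF mulr0.
Qed.

Lemma coord_le_enorm {R : realType} n (v : 'rV[R]_n) i : `|v 0 i| <= enorm v.
Proof.
apply: norm_le_of_sqr; first exact: enorm_ge0.
rewrite enorm_sqr /dotp (bigD1 i) //= expr2 lerDl.
by apply: sumr_ge0 => j _; rewrite -expr2 sqr_ge0.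
Qed.

Lemma dotp_near {R : realType} n (u v U V : 'rV[R]_n) (e : R) : 0 <= e -> e <= 1 ->
  (forall i, `|U 0 i - u 0 i| <= e) -> (forall i, `|V 0 i - v 0 i| <= e) ->
  `|dotp U V - dotp u v| <= e * \sum_(i < n) (`|u 0 i| + `|v 0 i| + 1).
Proof.
move=> e0 e1 Uu Vv; rewrite /dotp -sumrB mulr_sumr.
apply: le_trans (ler_norm_sum _ _ _) _; apply: ler_sum => i _.
move: (Uu i) (Vv i); move: (U 0 i) (V 0 i) (u 0 i) (v 0 i) => x y a b xa yb.
have -> : x * y - a * b = (x - a) * (y - b) + (x - a) * b + a * (y - b) by ring.
apply: le_trans (ler_normD _ _) _; apply: le_trans (lerD (ler_normD _ _) (lexx _)) _.
rewrite !normrM.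
have h1 : `|x - a| * `|y - b| <= e * 1.
  by apply: ler_pM => //; exact: le_trans e1.
have h2 : `|x - a| * `|b| <= e * `|b| by rewrite ler_wpM2r.
have h3 : `|a| * `|y - b| <= `|a| * e by rewrite ler_wpM2l.
lra.
Qed.

(** The corners are at distance t/sqrt 2 from a centre that is t away from the circle; 3/4 is a
    rational bound for 1/sqrt 2. *)
Lemma square_near_boundary {R : realType} (z0 w : R * R) (t : R) :
  normsq z0 = 1 -> 0 < t -> t <= 1 / 2 ->
  `|w.1 - (1 - t) * z0.1| <= t / 2 -> `|w.2 - (1 - t) * z0.2| <= t / 2 ->
  udisc w /\ cnorm (w - z0) < 2 * t.
Proof.
move=> z01 t0 t2; set v1 := w.1 - _; set v2 := w.2 - _ => V1 V2.
have sq (v : R) : `|v| <= t / 2 -> v ^+ 2 <= (t / 2) ^+ 2.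
  move=> vt; rewrite -[v ^+ 2]real_normK ?num_real //.
  by rewrite ler_pXn2r ?nnegrE //; lra.
have {}V1 := sq _ V1; have {}V2 := sq _ V2.
pose p := z0.1 * v1 + z0.2 * v2.
have pt : `|p| <= 3 / 4 * t.
  apply: norm_le_of_sqr; first lra.
  have : p ^+ 2 + (z0.1 * v2 - z0.2 * v1) ^+ 2 = normsq z0 * (v1 ^+ 2 + v2 ^+ 2).
    by rewrite /p /normsq; ring.
  rewrite z01; have := sqr_ge0 (z0.1 * v2 - z0.2 * v1).
  have := sqr_ge0 t; move: V1 V2; rewrite !exprMn; lra.
move: pt; rewrite ler_norml => /andP[p1 p2].
have tt : 0 < t ^+ 2 by rewrite exprn_gt0.
split.
  rewrite /udisc /=.
  have -> : w.1 ^+ 2 + w.2 ^+ 2 =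
      (1 - t) ^+ 2 * normsq z0 + 2 * (1 - t) * p + (v1 ^+ 2 + v2 ^+ 2).
    by rewrite /p /normsq /v1 /v2; ring.
  rewrite z01.
  have : (1 - t) * p <= (1 - t) * (3 / 4 * t) by rewrite ler_wpM2l //; lra.
  move: V1 V2; rewrite !exprMn; lra.
rewrite /cnorm -[ltRHS]ger0_norm; last lra.
rewrite -sqrtr_sqr ltr_sqrt; last by rewrite exprn_gt0 //; lra.
have -> : (w - z0).1 ^+ 2 + (w - z0).2 ^+ 2 =
    t ^+ 2 * normsq z0 - 2 * t * p + (v1 ^+ 2 + v2 ^+ 2).
  by rewrite /p /normsq /v1 /v2 /=; ring.
rewrite z01.
have : t * - p <= t * (3 / 4 * t) by rewrite ler_pM2l //; lra.
move: V1 V2; rewrite !exprMn; lra.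
Qed.

Section BoundaryDifferential.
Variables (R : realType) (n : nat) (F : R * R -> 'rV[R]_n) (z0 : R * R) (a b : 'rV[R]_n).
Hypothesis FF : conformal_minimal_immersion F.
Hypothesis z01 : normsq z0 = 1.
Hypothesis dF : boundary_differential F z0 a b.

(** Each coordinate of F minus its affine approximation at z0 is harmonic and o(t) on a square of
    size comparable to t near z0. The gradient estimate divides by t, so the partials at the centre
    tend to a and b. *)
Lemma boundary_partials (e : R) : 0 < e -> exists2 z, udisc z &
  forall i, `|partial_x F z 0 i - a 0 i| <= e /\ `|partial_y F z 0 i - b 0 i| <= e.
Proof.
(* With M = (e/8)(2 t) and half-side t/2, the gradient bound 2 M / (t/2) equals e. *)
move=> e0; have e80 : 0 < e / 8 by rewrite divr_gt0.
have [d d0 H] := dF e80.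
pose t := Num.min d 1 / 2.
have m0 : 0 < Num.min d 1 by rewrite lt_min d0 ltr01.
have [md m1] : Num.min d 1 <= d /\ Num.min d 1 <= 1 by rewrite !ge_min !lexx orbT.
have t0 : 0 < t by rewrite divr_gt0.
have t2 : t <= 1 / 2 by rewrite /t; lra.
have td : 2 * t <= d by rewrite /t; lra.
clearbody t.
pose z : R * R := ((1 - t) * z0.1, (1 - t) * z0.2).
have zD : udisc z.
  by have [] := @square_near_boundary R z0 z t z01 t0 t2; rewrite ?subrr ?normr0 //; lra.
exists z => // i.
have [h dh] := harmonic_dotp (delta_mx 0 i) FF.
have [dx dy] := dh z zD; have [hd _ _ _] := h z zD.
pose G (w : R * R) := dotp (F w) (delta_mx 0 i).
pose A (w : R * R) := (z0.1 * a 0 i + z0.2 * b 0 i - F z0 0 i) + (- a 0 i) * w.1 + (- b 0 i) * w.2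
  + 0 * w.1 ^+ 2 + 0 * w.2 ^+ 2.
pose u w := G w + A w.
have uP (w : R * R) : `|w.1 - z.1| <= t / 2 -> `|w.2 - z.2| <= t / 2 ->
     [/\ {for w, continuous u}, laplacian_at u w 0 & `|u w| <= e / 8 * (2 * t)].
  move=> w1 w2; have [wD wz] := square_near_boundary z01 t0 t2 w1 w2.
  split.
  - have Gc : {for w, continuous G}.
      by have [gd _ _ _] := h w wD; exact: differentiable_continuous.
    have z1 : {for w, continuous (fun w : R * R => w.1)} by exact: cvg_fst.
    have z2 : {for w, continuous (fun w : R * R => w.2)} by exact: cvg_snd.
    have cc (x : R) : {for w, continuous (fun _ : R * R => x)} by exact: cst_continuous.
    exact: (continuousD Gc (continuousD (continuousD (continuousD (continuousD (cc _)
      (continuousM (cc _) z1)) (continuousM (cc _) z2)) (continuousM (cc _) (continuousM z1 z1)))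
      (continuousM (cc _) (continuousM z2 z2)))).
  - have := laplacian_atD (harmonic_laplacian h wD)
      (laplacian_at_quad (z0.1 * a 0 i + z0.2 * b 0 i - F z0 0 i) (- a 0 i) (- b 0 i) 0 0 w).
    by rewrite !mulr0 !addr0.
  - have := H w wD (lt_le_trans wz td).
    move/(le_trans (coord_le_enorm _ i)); rewrite !mxE.
    have -> : F w 0 i - F z0 0 i - ((w.1 - z0.1) * a 0 i + (w.2 - z0.2) * b 0 i) = u w.
      by rewrite /u /G /A dotp_delta; ring.
    move/le_trans; apply; rewrite ler_pM2l //; exact: ltW.
have t20 : 0 < t / 2 by rewrite divr_gt0.
have lin (x s : R) : is_derive s 1 (fun y => x + y) 1.
  by apply: is_derive_eq; rewrite /GRing.scale /=; ring.
have cst (x s : R) : is_derive s 1 (fun _ : R => x) 0 by exact: is_derive_cst.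
have E : 2 * (e / 8 * (2 * t)) / (t / 2) = e by field; rewrite gt_eqF.
have z0' : (z.1 + 0, z.2) = z by rewrite addr0.
have z0'' : (z.1, z.2 + 0) = z by rewrite addr0.
split; rewrite -E.
  apply: (gradient_bound1 t20 uP).
  have hd' : differentiable G (z.1 + 0, z.2) by rewrite z0'.
  have k1 := @is_derive_curve R G (fun s => z.1 + s) (fun=> z.2) 0 1 0 hd' (lin _ _) (cst _ _).
  have k2 : is_derive (0 : R) 1 (fun s => A (z.1 + s, z.2)) (- a 0 i).
    rewrite /A /=; apply: is_derive_eq; rewrite /GRing.scale /=; ring.
  apply: (is_derive_eq (is_deriveD k1 k2)).
  by rewrite mul1r mul0r addr0 z0' /G dx dotp_delta.
apply: (gradient_bound2 t20 uP).
have hd' : differentiable G (z.1, z.2 + 0) by rewrite z0''.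
have k1 := @is_derive_curve R G (fun=> z.1) (fun s => z.2 + s) 0 0 1 hd' (cst _ _) (lin _ _).
have k2 : is_derive (0 : R) 1 (fun s => A (z.1, z.2 + s)) (- b 0 i).
  rewrite /A /=; apply: is_derive_eq; rewrite /GRing.scale /=; ring.
apply: (is_derive_eq (is_deriveD k1 k2)).
by rewrite mul1r mul0r add0r z0'' /G dy dotp_delta.
Qed.

Lemma boundary_conformal : dotp a a = dotp b b /\ dotp a b = 0.
Proof.
pose C (u v : 'rV[R]_n) := \sum_(i < n) (`|u 0 i| + `|v 0 i| + 1).
have C0 u v : 0 <= C u v by apply: sumr_ge0 => i _; rewrite !addr_ge0.
have small (x K : R) : 0 <= K -> (forall e, 0 < e -> e <= 1 -> `|x| <= e * K) -> x = 0.
  move=> K0 xK; apply/eqP; rewrite -normr_eq0 eq_le normr_ge0 andbT.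
  apply/ler_addgt0Pr => e e0; rewrite add0r.
  pose d := Num.min 1 (e / (K + 1)).
  have d0 : 0 < d by rewrite lt_min ltr01 divr_gt0 //; lra.
  have [d1 d2] : d <= 1 /\ d <= e / (K + 1) by rewrite !ge_min !lexx orbT.
  apply: le_trans (xK d d0 d1) _.
  have : d * (K + 1) <= e by rewrite -ler_pdivlMr //; lra.
  lra.
have arith (p x y K L e : R) : `|p - x| <= e * K -> `|p - y| <= e * L -> `|x - y| <= e * (K + L).
  by rewrite !ler_norml; lra.
split.
  apply/eqP; rewrite -subr_eq0; apply/eqP.
  apply: (small _ (C a a + C b b)); first by rewrite addr_ge0.
  move=> e e0 e1; have [z zD H] := boundary_partials e0.
  have [_ _ conf _] := FF; have [xy _] := conf z zD.
  have h1 := dotp_near (ltW e0) e1 (fun i => (H i).1) (fun i => (H i).1).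
  have h2 := dotp_near (ltW e0) e1 (fun i => (H i).2) (fun i => (H i).2).
  have E : dotp (partial_x F z) (partial_x F z) = dotp (partial_y F z) (partial_y F z).
    by rewrite -(enorm_sqr (partial_y F z)) -xy enorm_sqr.
  rewrite E in h1; exact: arith h1 h2.
apply: (small _ (C a b)) => // e e0 e1; have [z zD H] := boundary_partials e0.
have [_ _ conf _] := FF; have [_ xy] := conf z zD.
have := dotp_near (ltW e0) e1 (fun i => (H i).1) (fun i => (H i).2).
by rewrite xy sub0r normrN.
Qed.

(** A conformal differential stretches all unit directions equally, so the radial derivative
    measures |dF(z0)|. *)
Lemma enorm_boundary_radial : enorm (z0.1 *: a + z0.2 *: b) = enorm a.
Proof.
have [ab0 ab] := boundary_conformal; rewrite /enorm; congr (Num.sqrt _).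
rewrite !(dotpDl, dotpDr, dotpZl, dotpZr) (dotpC b a) ab -ab0.
apply: (@eq_trans _ _ (normsq z0 * dotp a a)); first by rewrite /normsq; ring.
by rewrite z01 mul1r.
Qed.

End BoundaryDifferential.

(** * Comparison of growth and differential at the boundary point *)

Unset Implicit Arguments.

Theorem theorem3p2 (R : realType) (n : nat) (F : R * R -> 'rV[R]_n)
    (z0 : R * R) (a b : 'rV[R]_n) :
  (3 <= n)%N ->
  conformal_minimal_immersion F ->
  (forall z, udisc z -> enorm (F z) < 1) ->
  cnorm z0 = 1 ->
  enorm (F z0) = 1 ->
  boundary_differential F z0 a b ->
  enorm a >= (1 - enorm (F (0, 0))) / (1 + enorm (F (0, 0))).
Proof.
move=> _ FF F1 z0n Fz0 dF.
have z01 : normsq z0 = 1.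
  have : cnorm z0 ^+ 2 = 1 by rewrite z0n expr1n.
  by rewrite /cnorm sqr_sqrtr // addr_ge0 ?sqr_ge0.
rewrite -(enorm_boundary_radial FF z01 dF); set nu := _ *: _ + _ *: _.
apply/ler_addgt0Pr => e e0; have [d d0 H] := dF e e0.
pose t := Num.min d 1 / 2.
have m0 : 0 < Num.min d 1 by rewrite lt_min d0 ltr01.
have [md m1] : Num.min d 1 <= d /\ Num.min d 1 <= 1 by rewrite !ge_min !lexx orbT.
have t0 : 0 < t by rewrite divr_gt0.
have t1 : t < 1 by rewrite /t; lra.
have td : t < d by rewrite /t; lra.
clearbody t.
pose z : R * R := ((1 - t) * z0.1, (1 - t) * z0.2).
have zz : normsq z = (1 - t) ^+ 2.
  by rewrite /normsq /= !exprMn -mulrDr -/(normsq z0) z01 mulr1.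
have zD : udisc z by rewrite /udisc /= -/(normsq z) zz expr_lt1 //; lra.
have zc : cnorm (z - z0) = t.
  rewrite /cnorm -[RHS]ger0_norm ?ltW // -sqrtr_sqr; congr (Num.sqrt _).
  have -> : (z - z0).1 ^+ 2 + (z - z0).2 ^+ 2 = t ^+ 2 * normsq z0 by rewrite /normsq /=; ring.
  by rewrite z01 mulr1.
have := H z zD; rewrite zc => /(_ td).
set E := F z - F z0 - _ => Ee.
(* Pairing the expansion at z0 with the unit vector F(z0) bounds |F(z)| from below. *)
have lower : 1 - enorm (F z) <= t * (e + enorm nu).
  have qq : dotp (F z0) (F z0) = 1 by rewrite -enorm_sqr Fz0 expr1n.
  have EE : F z = F z0 + E + (- t) *: nu.
    have -> : (- t) *: nu = (z.1 - z0.1) *: a + (z.2 - z0.2) *: b.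
      by rewrite /nu scalerDr !scalerA; congr (_ *: _ + _ *: _) => /=; ring.
    by rewrite /E -[RHS]addrA subrK addrC subrK.
  clearbody E; have := dotp_unit_le (F z) qq.
  rewrite {1}EE !dotpDl dotpZl qq.
  have := dotp_unit_le E qq; have := dotp_unit_le nu qq.
  move: Ee; move: (dotp E _) (dotp nu _) (enorm nu) (enorm E) (enorm (F z)) => x y N e1 f.
  rewrite !ler_norml => Ee /andP[_ yN] /andP[xE _] /andP[_ Hf].
  have : t * y <= t * N by rewrite ler_pM2l.
  lra.
have := hyperbolic_growth FF F1 z01 (x := 1 - t) ltac:(lra) ltac:(lra).
rewrite -/z !mul0r.
have p1 : enorm (F (0, 0)) < 1 by apply: F1; rewrite /udisc /= !expr0n /= addr0.
have p0 := enorm_ge0 (F (0, 0)).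
have f1 := F1 z zD; have f0 := enorm_ge0 (F z).
move: (enorm (F z)) (enorm (F (0, 0))) (enorm nu) f0 f1 p0 p1 lower => f p N f0 f1 p0 p1 lower.
have fden : 0 < 1 - f * (1 - t).
  have : f * (1 - t) <= f by rewrite -[leRHS]mulr1 ler_wpM2l //; lra.
  lra.
rewrite !ler_pdivrMr // => [G|]; last by lra.
(* Cleared of denominators, the growth bound is t (1 - p f) <= (1 + p)(1 - f); this term lowers 1 -
   p f to 1 - p, and dividing by t concludes. *)
have : 0 <= (1 - f) * (p * t) by rewrite !mulr_ge0 //; lra.
have : (1 - f) * (1 + p) <= t * (e + N) * (1 + p) by rewrite ler_wpM2r //; lra.
move=> h1 h2; rewrite -(ler_pM2l t0); lra.
Qed.
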